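(* Let $q\in\{1,\dots,n-1\}$. Suppose that $\{\sigma_1,\dots,\sigma_k\}-\{\varepsilon_1,\dots,\varepsilon_{n-k}\}$ satisfies condition $(N_a)$, and that $c_q+d_q=n-q$, $c_q=0$ and $d_q=n-q$. Then: (1) Let $n-k$ be even, and let $\lambda_1<0$ be the biggest negative eigenvalue of $T_n[0]$ in $X_{\{\sigma_1,\dots,\sigma_k\}}^{\{\varepsilon_1,\dots,\varepsilon_{n-k}\}}$. - If $n-q$ is even, then $v_s^q[M]$ is nonnegative on $I\times I$ if and only if $M\in(\lambda_1,0]$. - If $n-q$ is odd, then $v_s^q[M]$ is nonpositive on $I\times I$ if and only if $M\in(\lambda_1,0]$. (2) Let $n-k$ be odd, and let $\lambda_1>0$ be the least positive eigenvalue of $T_n[0]$ in $X_{\{\sigma_1,\dots,\sigma_k\}}^{\{\varepsilon_1,\dots,\varepsilon_{n-k}\}}$. - If $n-q$ is even, then $v_s^q[M]$ is nonnegative on $I\times I$ if and only if $M\in[0,\lambda_1)$. - If $n-q$ is odd, then $v_s^q[M]$ is nonpositive on $I\times I$ if and only if $M\in[0,\lambda_1)$.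
   Context: Let $n\ge 2$, $I=[a,b]$, $M\in\mathbb{R}$, $T_n[M]u=u^{(n)}+Mu$, $k\in\{1,\dots,n-1\}$, and let $0\le\sigma_1<\dots<\sigma_k\le n-1$ and $0\le\varepsilon_1<\dots<\varepsilon_{n-k}\le n-1$ be integers. For sets $A,B\subset\{0,\dots,n-1\}$ let $X_A^B=\{u\in C^n(I): u^{(i)}(a)=0\ \forall i\in A,\ u^{(j)}(b)=0\ \forall j\in B\}$. A number $\lambda\in\mathbb{R}$ is called an eigenvalue of $T_n[0]$ in $X_A^B$ if there is $u\in X_A^B$, $u\not\equiv0$, with $u^{(n)}(t)+\lambda u(t)=0$ on $I$. Condition $(N_a)$: $\#\{j:\sigma_j<h\}+\#\{j:\varepsilon_j<h\}\ge h$ for all $h\in\{1,\dots,n-1\}$. $g_M(t,s)$ denotes the Green's function of $T_n[M]$ in $X_{\{\sigma_1,\dots,\sigma_k\}}^{\{\varepsilon_1,\dots,\varepsilon_{n-k}\}}$ (any assertion about $g_M$ for a given $M$ includes that it exists, i.e. that $M$ is not an eigenvalue of $T_n[0]$ in this space), and $v_s^q[M](t)=\frac{\partial^q}{\partial t^q}g_M(t,s)$ (for $q=n-1$ it is defined for $t\ne s$, with a jump at $t=s$). $c_q=\#\{i:\sigma_i\ge q\}$ and $d_q=\#\{i:\varepsilon_i\ge q\}$. *)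

(* Defs.v *)
From HB Require Import structures.
From mathcomp Require Import all_boot all_order all_algebra.
From mathcomp Require Import all_classical all_reals all_analysis.

Set Implicit Arguments.
Unset Strict Implicit.
Unset Printing Implicit Defensive.

Import Order.TTheory GRing.Theory Num.Theory.
Import numFieldNormedType.Exports.

Local Open Scope classical_set_scope.
Local Open Scope ring_scope.

(** Derivatives relative to the compact interval [a, b]: ordinary derivatives
    in the interior, one-sided at a and b.  The values of the functions outside
    [a, b] are irrelevant. *)

Definition diffq_within (R : realType) (a b : R) (f : R -> R) (t : R) :
    set_system R :=
  (f x - f t) / (x - t) @[x --> within `[a, b] t^'].

Definition derivable_within (R : realType) (a b : R) (f : R -> R) (t : R) : Prop :=
  cvg (diffq_within a b f t).

(** Total operator: the value at [t] is meaningful only when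
    [derivable_within a b f t] holds. *)
Definition derive_within (R : realType) (a b : R) (f : R -> R) (t : R) : R :=
  lim (diffq_within a b f t).

Definition deriven_within (R : realType) (a b : R) (i : nat) (f : R -> R) : R -> R :=
  iter i (derive_within a b) f.

Definition is_Cn (R : realType) (a b : R) (n : nat) (u : R -> R) : Prop :=
  (forall (i : nat) (t : R), (i < n)%N -> t \in `[a, b] ->
     derivable_within a b (deriven_within a b i u) t) /\
  {within `[a, b], continuous (deriven_within a b n u)}.

Definition boundary_conditions (R : realType) (a b : R) (n : nat)
    (A B : {set 'I_n}) (u : R -> R) : Prop :=
  (forall i : 'I_n, i \in A -> deriven_within a b i u a = 0) /\
  (forall j : 'I_n, j \in B -> deriven_within a b j u b = 0).

(** The space X_A^B. *)
Definition in_X (R : realType) (a b : R) (n : nat) (A B : {set 'I_n})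
    (u : R -> R) : Prop :=
  is_Cn a b n u /\ boundary_conditions a b A B u.

(** Sign convention: u^(n) + l u = 0. *)
Definition is_eigenvalue (R : realType) (a b : R) (n : nat) (A B : {set 'I_n})
    (l : R) : Prop :=
  exists u : R -> R,
    [/\ in_X a b A B u,
        exists2 t : R, t \in `[a, b] & u t != 0
      & forall t : R, t \in `[a, b] -> deriven_within a b n u t + l * u t = 0].

Definition is_biggest_negative_eigenvalue (R : realType) (a b : R) (n : nat)
    (A B : {set 'I_n}) (l : R) : Prop :=
  [/\ l < 0, is_eigenvalue a b A B l
    & forall l' : R, is_eigenvalue a b A B l' -> l' < 0 -> l' <= l].

Definition is_least_positive_eigenvalue (R : realType) (a b : R) (n : nat)
    (A B : {set 'I_n}) (l : R) : Prop :=
  [/\ 0 < l, is_eigenvalue a b A B l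
    & forall l' : R, is_eigenvalue a b A B l' -> 0 < l' -> l <= l'].

(** The i-th partial derivative of g with respect to its first variable.  On
    I x I away from the diagonal it only depends on g near (t, s), so for
    i = n-1, n it is meaningful for t != s even though g(., s) is only
    C^(n-2) across t = s. *)
Definition dt (R : realType) (a b : R) (i : nat) (g : R -> R -> R) (t s : R) : R :=
  deriven_within a b i (g ^~ s) t.

(** Green's function of u^(n) + M u in X_A^B, in the classical sense.  The
    clauses are, in order: existence and joint continuity on I x I of the
    t-derivatives of order at most n-2; existence of the t-derivatives of
    orders n-1 and n off the diagonal and their continuity on both triangles;
    the unit jump of the derivative of order n-1; the homogeneous equation
    off the diagonal; the boundary conditions. *)
Definition is_green (R : realType) (a b : R) (n : nat) (M : R)
    (A B : {set 'I_n}) (g : R -> R -> R) : Prop :=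
  (forall (i : nat) (t s : R), (i.+2 < n)%N -> t \in `[a, b] -> s \in `[a, b] ->
         derivable_within a b (fun x => dt a b i g x s) t) /\
  (forall i : nat, (i.+1 < n)%N ->
         {within `[a, b] `*` `[a, b],
            continuous (fun p : R * R => dt a b i g p.1 p.2)}) /\
  (forall (i : nat) (t s : R), (n.-2 <= i < n)%N ->
         t \in `[a, b] -> s \in `[a, b] -> t != s ->
         derivable_within a b (fun x => dt a b i g x s) t) /\
  (forall i : nat, (n.-1 <= i <= n)%N ->
         {within [set p : R * R | a <= p.2 /\ p.2 < p.1 /\ p.1 <= b],
            continuous (fun p : R * R => dt a b i g p.1 p.2)} /\
         {within [set p : R * R | a <= p.1 /\ p.1 < p.2 /\ p.2 <= b],
            continuous (fun p : R * R => dt a b i g p.1 p.2)}) /\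
  (forall s : R, s \in `]a, b[ ->
         exists lp lm : R,
           [/\ dt a b n.-1 g t s @[t --> s^'+] --> lp,
               dt a b n.-1 g t s @[t --> s^'-] --> lm
             & lp - lm = 1]) /\
  (forall t s : R, t \in `[a, b] -> s \in `]a, b[ -> t != s ->
         dt a b n g t s + M * g t s = 0) /\
  (forall s : R, s \in `]a, b[ -> boundary_conditions a b A B (g ^~ s)).

(** [P] holds for all values v_s^q[M](t), (t, s) in I x I; for q = n-1 the
    diagonal, where v_s^q[M] is undefined, is left out.  The existence of the
    Green's function is part of the assertion. *)
Definition green_deriv_sat (R : realType) (a b : R) (n : nat) (M : R)
    (A B : {set 'I_n}) (q : nat) (P : R -> Prop) : Prop :=
  ~ is_eigenvalue a b A B M /\
  exists2 g : R -> R -> R, is_green a b M A B g &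
    forall t s : R, t \in `[a, b] -> s \in `[a, b] -> (q = n.-1 -> t != s) ->
      P (dt a b q g t s).

Definition green_deriv_nonneg (R : realType) (a b : R) (n : nat) (M : R)
    (A B : {set 'I_n}) (q : nat) : Prop :=
  green_deriv_sat a b M A B q (fun y => 0 <= y).

Definition green_deriv_nonpos (R : realType) (a b : R) (n : nat) (M : R)
    (A B : {set 'I_n}) (q : nat) : Prop :=
  green_deriv_sat a b M A B q (fun y => y <= 0).

Definition strictly_increasing (m n : nat) (f : 'I_m -> 'I_n) : Prop :=
  forall i j : 'I_m, (i < j)%N -> (f i < f j)%N.

Definition index_set (m n : nat) (f : 'I_m -> 'I_n) : {set 'I_n} :=
  [set f i | i : 'I_m]%SET.

Definition nb_lt (m n : nat) (f : 'I_m -> 'I_n) (h : nat) : nat :=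
  #|[pred j : 'I_m | (f j < h)%N]|.

Definition nb_ge (m n : nat) (f : 'I_m -> 'I_n) (h : nat) : nat :=
  #|[pred j : 'I_m | (h <= f j)%N]|.

Definition condition_Na (n k : nat) (sigma : 'I_k -> 'I_n)
    (eps : 'I_(n - k) -> 'I_n) : Prop :=
  forall h : nat, (1 <= h <= n.-1)%N -> (h <= nb_lt sigma h + nb_lt eps h)%N.

(* Main.v *)
(* The conditions c_q = 0 and d_q = n - q say that no derivative of order at least q
   is prescribed at a, while all of them are prescribed at b.  Hence u |-> u^(q) turns
   the problem into w = L_s + m K w, where m is M up to sign, L_s is the backward
   Taylor kernel (s - t)_+^(n-1-q)/(n-1-q)! up to sign, and K is positive.

   Positivity of K is a sign lemma for Polya systems: the mean value theorem and the
   boundary conditions turn an alternation of signs of u^(i) into one of u^(i+1), and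
   counting shows that u cannot take a single value of the wrong sign when u^(q) has
   constant sign.

   Write Y_m for w at s = b.  If Y_m >= 0 then Y_m >= L_b and Y_m is comparable to L_b,
   so that m K Y_m = Y_m - L_b <= (1 - d) Y_m with d > 0.  This contraction in the norm
   weighted by Y_m yields both directions: an eigenfunction with eigenvalue not larger
   than m must vanish, and w >= 0 for every s.  The set of m >= 0 below the first
   eigenvalue such that Y_m >= 0 contains 0 and is open and closed.  For m < 0 and
   w >= 0, the Green's function vanishes to the right of s, and a boundary condition at
   a then makes it vanish to the left of s, against its jump. *)

Require Import Defs.
From mathcomp Require Import all_boot all_order all_algebra.
From mathcomp Require Import all_classical all_reals all_analysis.
From mathcomp Require Import zify ring lra.

Import Order.TTheory GRing.Theory Num.Theory.
Import numFieldNormedType.Exports.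

Local Open Scope ring_scope.

Set Implicit Arguments.
Unset Strict Implicit.
Unset Printing Implicit Defensive.

Local Open Scope classical_set_scope.

(** * Sign of solutions of two-point boundary problems *)

(** The kernel operators of the overview are never formed: every estimate goes through derivatives.
    With [M = - (w * m)] the equation is u^(n) = w m u. If m >= 0 and w u >= 0, then u^(n-1)
    increases up to its value at b, n-1-q integrations from b give the sign of u^(q), and the sign
    lemma returns w u >= 0. The contraction is one turn of this loop. Functions are measured by a
    bound on order n-1, because it makes u^(q) at most a multiple of the weight
    (b-t)^(n-1-q)/(n-1-q)! and so matches the degeneracy at b. The same weight gives openness in m:
    nonnegativity at s = b already forces the derivative of order q, up to sign, above the weight,
    whereas a change of order n-1 by at most 1/2 moves it by at most half the weight. For a given
    Green's function the obstacle is the edge s = b, since [is_green] states the equation, the jump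
    and the boundary conditions only for s inside the interval. There they are recovered as limits;
    order n-1, where the diagonal meets the corner (b, b), requires an estimate of its own. *)

Section SignLemma.
Context {R : realType}.
Implicit Types (a b s c t x y : R) (f : nat -> R -> R).

(* The exceptional point [s] accommodates the jump of a Green's function. *)
Definition chain a b s (q : nat) f : Prop := forall i : nat, (i < q)%N ->
  {within `[a, b], continuous (f i)} /\
  (forall t, a < t -> t < b -> t != s -> is_derive t 1 (f i) (f i.+1 t)).

(** A mean value theorem that survives the missing derivative at [s]: if [s] lies between [x] and
    [y], the increment is the sum of those over the two pieces, and one of them has the sign of
    [c]. *)
Lemma exists_slope a b s (g g' : R -> R) c x y :
  {within `[a, b], continuous g} ->
  (forall t, a < t -> t < b -> t != s -> is_derive t 1 g (g' t)) ->
  a <= x -> x < y -> y <= b -> 0 < c * (g y - g x) ->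
  exists z, [/\ x < z, z < y, z != s & 0 < c * g' z].
Proof.
move=> cg dg.
have piece u v : a <= u -> u < v -> v <= b -> ~~ (u < s < v) ->
    0 < c * (g v - g u) -> exists z, [/\ u < z, z < v, z != s & 0 < c * g' z].
  move=> au uv vb suv cuv.
  have ns z : u < z -> z < v -> z != s.
    by move=> uz zv; apply: contra suv => /eqP <-; rewrite uz zv.
  have [||z] := MVT uv (f := g) (df := g').
  - move=> z; rewrite in_itv/= => /andP[uz zv].
    by apply: dg; [exact: le_lt_trans uz|exact: lt_le_trans vb|exact: ns].
  - apply: continuous_subspaceW cg => z /=; rewrite !in_itv/= => /andP[uz zv].
    by rewrite (le_trans au uz) (le_trans zv vb).
  rewrite in_itv/= => /andP[uz zv] E; exists z; split => //; first exact: ns.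
  by move: cuv; rewrite E mulrA pmulr_lgt0 // subr_gt0.
move=> ax xy yb cxy; have [/andP[xs sy]|] := boolP (x < s < y); last first.
  by move=> nxy; exact: piece.
have [csy|] := ltP 0 (c * (g y - g s)).
  have [|||||z [sz zy zs cz]] := piece s y => //; first by rewrite (le_trans ax)// ltW.
  - by rewrite ltxx.
  by exists z; split => //; exact: lt_trans sz.
move=> csy; have [|||||z [xz zs zns cz]] := piece x s => //.
- by rewrite (le_trans _ yb)// ltW.
- by rewrite ltxx andbF.
- have -> : c * (g s - g x) = c * (g y - g x) - c * (g y - g s) by ring.
  by rewrite subr_gt0; exact: le_lt_trans cxy.
by exists z; split => //; exact: lt_trans sy.
Qed.

(* [alternates f c lo xs]: [xs] increases from [lo] to [b], avoids [s], and along
   it [f] takes nonzero values of alternating sign, the first of the sign of [c]. *)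
Fixpoint alternates (b s : R) (g : R -> R) (c lo : R) (xs : seq R) : Prop :=
  if xs is x :: xs' then
    [/\ lo < x, x < b, x != s, 0 < c * g x & alternates b s g (- c) x xs']
  else True.

Lemma alternates_lo b s g c lo lo' xs :
  lo' <= lo -> alternates b s g c lo xs -> alternates b s g c lo' xs.
Proof. by case: xs => //= x xs le [lox]; split => //; exact: le_lt_trans lox. Qed.

(** Rolle's argument with signs: each gap between consecutive points of the alternation yields one
    slope, and a zero at [b] yields one more after the last point. *)
Lemma alternates_derive a b s (g g' : R -> R) (endb : bool) c x xs :
  {within `[a, b], continuous g} ->
  (forall t, a < t -> t < b -> t != s -> is_derive t 1 g (g' t)) ->
  (endb -> g b = 0) ->
  a <= x -> x < b -> 0 < c * g x -> alternates b s g (- c) x xs ->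
  exists ys, size ys = (size xs + endb)%N /\ alternates b s g' (- c) x ys.
Proof.
move=> cg dg gb; elim: xs c x => [|y xs IH] c x ax xb cx /=.
  move=> _; case: endb gb => [gb|_]; last by exists [::].
  have [|z [xz zb zs cz]] := exists_slope (c := - c) cg dg ax xb (lexx b).
    by rewrite gb// sub0r mulrNN.
  by exists [:: z].
case=> xy yb ys cy alt.
have [||||zs [szs altz]] := IH (- c) y => //; first by rewrite (le_trans ax)// ltW.
have [|z [xz zy zns cz]] := exists_slope (c := - c) cg dg ax xy (ltW yb).
  by rewrite mulrBr subr_gt0 (lt_trans _ cy)// mulNr oppr_lt0.
exists (z :: zs); split; first by rewrite /= szs addSn.
split => //; first exact: lt_trans yb.
by apply: alternates_lo altz; exact: ltW.
Qed.

(** Each passage from [f i] to [f i.+1] costs one point of the alternation and regains one for every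
    boundary condition of order i. A zero at a adds a point in front and keeps the leading sign;
    without it the leading sign flips, whence the parity of the orders outside [A]. At order q at
    most one point is left, a positive one. The bound on tails covers alternations that have run
    out. *)
Lemma alternates_size a b s q f (A B : nat -> bool) (p : bool) xs :
  chain a b s q f ->
  (forall i, (i < q)%N -> A i -> f i a = 0) ->
  (forall i, (i < q)%N -> B i -> f i b = 0) ->
  (forall i, (i <= q)%N -> (\sum_(i <= j < q) (A j + B j) <= q - i)%N) ->
  (forall t, a < t -> t < b -> t != s -> 0 <= f q t) ->
  alternates b s (f 0%N) ((-1) ^+ p) a xs ->
  (size xs + \sum_(0 <= j < q) (A j + B j) <=
    q + (p == odd (\sum_(0 <= j < q) ~~ A j)))%N.
Proof.
elim: q f A B p xs => [|q IH] f A B p xs ch fA fB tails fq.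
  rewrite !big_geq// addn0 add0n /=.
  case: xs => //= x xs [ax xb xs1 cx alt]; case: p cx alt => /=.
    by rewrite expr1 mulN1r oppr_gt0 ltNge fq.
  rewrite expr0; case: xs => //= y xs _ [xy yb ys].
  by rewrite mulN1r oppr_gt0 ltNge fq// (lt_trans ax).
have tails0 := tails 0%N (leq0n _).
case: xs => [|x xs]; first by move=> _; rewrite add0n; lia.
case=> ax xb xns px alt.
have [cf0 df0] := ch 0%N isT.
have IHf := IH (fun i => f i.+1) (fun i => A i.+1) (fun i => B i.+1).
have shift (F : nat -> nat) k :
    \sum_(k <= j < q) F j.+1 = \sum_(k.+1 <= j < q.+1) F j.
  by rewrite big_add1 //=.
have {}IHf (p' : bool) xs' : alternates b s (f 1%N) ((-1) ^+ p') a xs' -> 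
   (size xs' + \sum_(1 <= j < q.+1) (A j + B j) <=
    q + (p' == odd (\sum_(1 <= j < q.+1) ~~ A j)))%N.
  move=> alt'; have := IHf p' xs'; rewrite (shift (fun j => A j + B j)%N).
  rewrite (shift (fun j => nat_of_bool (~~ A j))); apply => //.
  - by move=> i iq; exact: ch.
  - by move=> i iq; exact: fA.
  - by move=> i iq; exact: fB.
  - by move=> i iq; rewrite (shift (fun j => A j + B j)%N) -subSS; exact: tails.
rewrite !(big_ltn (ltn0Sn q)).
have [] := alternates_derive (endb := B 0%N) cf0 df0 _ (ltW ax) xb px alt.
  by move=> B0; exact: fB.
move=> ys [sys alty]; case: (boolP (A 0%N)) => A0 /=; last first.
  have := IHf (~~ p) ys; rewrite sys signrN.
  move=> /(_ (alternates_lo (ltW ax) alty)); rewrite oddD /=.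
  by case: p {px alt alty} => /=; case: (odd _) => /=; lia.
have [|z [az zx zs cz]] := exists_slope (c := (-1) ^+ p) cf0 df0 (lexx a) ax (ltW xb).
  by rewrite (fA 0%N)// subr0.
have := IHf p (z :: ys); rewrite /= sys => /(_ _)/wrap[].
  split => //; first exact: lt_trans xb.
  by apply: alternates_lo alty; exact: ltW.
rewrite add0n; move: (\sum_(1 <= j < q.+1) (A j + B j))%N (nat_of_bool (p == _)) (nat_of_bool (B 0%N)).
by move: (size xs) => m S e B0; clear; lia.
Qed.

Lemma ge0_itv_closure a b s (g : R -> R) :
  a < b -> {within `[a, b], continuous g} ->
  (forall t, a < t -> t < b -> t != s -> 0 <= g t) ->
  forall t, a <= t -> t <= b -> 0 <= g t.
Proof.
move=> ab /subspace_continuousP cg g0 t ta tb; rewrite leNgt; apply/negP => gt0.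
have tab : `[a, b]%classic t by rewrite /= in_itv/= ta tb.
have := cg t tab => /(@cvgr_lt _ _ _ _ _ _)/(_ _ gt0).
rewrite near_withinE => /nbhs_ballP[e /= e0 He].
have neg x : a <= x -> x <= b -> `|t - x| < e -> g x < 0.
  by move=> ax xb xt; apply: He => //=; rewrite in_itv/= ax xb.
pose l := Num.max a (t - e); pose r := Num.min b (t + e).
have lr : l < r.
  rewrite /l /r lt_min !gt_max ab/=.
    by apply/andP; split; [|apply/andP; split]; lra.
have contra x : l < x -> x < r -> x != s -> False.
  rewrite lt_min gt_max => /andP[ax tx] /andP[xb xt] xs.
  have := g0 x ax xb xs; rewrite leNgt => /negP; apply.
  by apply: neg; rewrite ?ltW// ltr_distlC; apply/andP; split; lra.
(* If the midpoint happens to be the excluded point, the quarter point is not. *)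
have [sl|sl] := eqVneq ((l + r) / 2) s; last first.
  by apply: (contra ((l + r) / 2)) => //; lra.
apply: (contra ((l + s) / 2)); try (by lra).
Qed.

(* Boundary conditions satisfying Polya's condition: by [alternates_size], [f 0]
   cannot take even one value of the wrong sign. *)
Lemma sign_of_boundary_problem a b s q f (A B : nat -> bool) :
  chain a b s q f ->
  (forall i, (i < q)%N -> A i -> f i a = 0) ->
  (forall i, (i < q)%N -> B i -> f i b = 0) ->
  (forall i, (i <= q)%N -> (\sum_(i <= j < q) (A j + B j) <= q - i)%N) ->
  (\sum_(0 <= j < q) (A j + B j))%N = q ->
  (forall t, a < t -> t < b -> t != s -> 0 <= f q t) ->
  forall t, a < t -> t < b -> t != s ->
    0 <= (-1) ^+ (\sum_(0 <= j < q) ~~ A j)%N * f 0%N t.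
Proof.
move=> ch fA fB tails total fq t ta tb ts; rewrite leNgt; apply/negP => neg.
(* A wrong sign at [t] is an alternation of length one, and for this parity the count reads 1 + q <=
   q. *)
have := alternates_size (p := ~~ odd (\sum_(0 <= j < q) ~~ A j)) (xs := [:: t])
  ch fA fB tails fq.
rewrite total /= => /(_ _)/wrap[].
  by split => //; rewrite signrN mulNr oppr_gt0 signr_odd.
by case: (odd _) => /=; lia.
Qed.

End SignLemma.

(** * Chains of successive derivatives *)

Section ChainCalculus.
Context {R : realType}.
Implicit Types (a b s c t x y : R) (f g : nat -> R -> R) (h : R -> R).

Lemma within_itv_sub a b a' b' h : a <= a' -> b' <= b ->
  {within `[a, b], continuous h} -> {within `[a', b'], continuous h}.
Proof.
move=> aa bb; apply: continuous_subspaceW => z /=; rewrite !in_itv/= => /andP[az zb].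
by rewrite (le_trans aa az) (le_trans zb bb).
Qed.

Lemma chain_weaken a b s q q' a' b' s' f :
  (q' <= q)%N -> a <= a' -> b' <= b -> (forall t, a' < t -> t < b' -> t != s' -> t != s) ->
  chain a b s q f -> chain a' b' s' q' f.
Proof.
move=> qq aa bb ss ch i iq; have [cf df] := ch i (leq_trans iq qq); split.
  exact: within_itv_sub cf.
by move=> t ta tb ts; apply: df; [exact: le_lt_trans ta|exact: lt_le_trans bb|exact: ss].
Qed.

Lemma chain_shift a b s q p f :
  chain a b s (p + q) f -> chain a b s q (fun i => f (p + i)%N).
Proof. by move=> ch i iq; rewrite addnS; apply: ch; rewrite ltn_add2l. Qed.

Lemma chain_lin a b s q c d f g : chain a b s q f -> chain a b s q g ->
  chain a b s q (fun i t => c * f i t + d * g i t).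
Proof.
move=> chf chg i iq; have [cf df] := chf i iq; have [cg dg] := chg i iq; split.
  move/subspace_continuousP in cf; move/subspace_continuousP in cg.
  apply/subspace_continuousP => t tab.
  by apply: cvgD; apply: cvgM; [exact: cvg_cst|exact: cf|exact: cvg_cst|exact: cg].
move=> t ta tb ts; have ? := df t ta tb ts; have ? := dg t ta tb ts.
have /= H : is_derive t 1 (c *: f i + d *: g i) (c *: f i.+1 t + d *: g i.+1 t).
  exact: is_deriveD.
exact: H.
Qed.

Lemma le_of_derive_ge0 a b s (h h' : R -> R) x y :
  {within `[a, b], continuous h} ->
  (forall t, a < t -> t < b -> t != s -> is_derive t 1 h (h' t)) ->
  (forall t, a < t -> t < b -> t != s -> 0 <= h' t) ->
  a <= x -> x <= y -> y <= b -> h x <= h y.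
Proof.
move=> ch dh h0 ax; rewrite le_eqVlt => /predU1P[->//|xy yb].
rewrite leNgt; apply/negP => hyx.
have [|z [xz zy zs]] := exists_slope (c := -1) ch dh ax xy yb.
  by rewrite mulN1r opprB subr_gt0.
rewrite mulN1r oppr_gt0 ltNge h0//; first exact: le_lt_trans xz.
exact: lt_le_trans yb.
Qed.

Lemma bounded_within a b h : {within `[a, b], continuous h} ->
  exists2 C : R, 0 < C & forall t, a <= t -> t <= b -> `|h t| <= C.
Proof.
move=> ch; have /compact_bounded[C [_ HC]] := continuous_compact ch (@segment_compact _ a b).
exists (Num.max 0 C + 1); first by rewrite ltr_wpDl// le_max lexx.
move=> t ta tb; apply: HC; first by rewrite (@le_lt_trans _ _ (Num.max 0 C))// ?le_max ?lexx ?orbT// ltrDl.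
by exists t => //=; rewrite in_itv/= ta tb.
Qed.

Lemma is_derive_ext h h' t d d' :
  h =1 h' -> d = d' -> is_derive t 1 h d -> is_derive t 1 h' d'.
Proof. by move=> /funext -> ->. Qed.

Lemma is_derive_monomial b (k : nat) t :
  is_derive t 1 (fun x => (x - b) ^+ k.+1 / k.+1`!%:R) ((t - b) ^+ k / k`!%:R).
Proof.
pose h x : R := x - b.
have dh : is_derive t 1 h (1 - 0 : R) by exact: (@is_deriveB _ _ _ id (cst b)).
apply: is_derive_ext (is_deriveZ (k.+1`!%:R^-1 : R) (is_deriveX k.+1 dh)).
  by move=> x; rewrite fctE /GRing.scale/= mulrC.
rewrite /= subr0 /GRing.scale/= mulr1 factS natrM /h.
by rewrite invfM mulrACA mulVf ?pnatr_eq0// mul1r mulrC.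
Qed.

Lemma continuous_monomial b (k : nat) : continuous (fun x : R => (x - b) ^+ k / k`!%:R).
Proof.
move=> t; apply: cvgM; last exact: cvg_cst.
apply: (@cvg_comp _ _ _ (fun x => x - b) (fun y => y ^+ k)).
  by apply: cvgB; [exact: cvg_id|exact: cvg_cst].
exact: exprn_continuous.
Qed.

(** Taylor's inequality at [b] without integrals: the monomial [P] has r-th derivative 1 and
    vanishes at [b] in all lower orders, so the sign lemma with every condition at [b] applies to -f
    - c P. *)
Lemma integrate_from_right a b s r c f :
  chain a b s r f -> (forall i, (i < r)%N -> f i b = 0) ->
  (forall t, a < t -> t < b -> t != s -> f r t <= - c) ->
  forall t, a < t -> t < b -> t != s ->
    c * ((b - t) ^+ r / r`!%:R) <= (-1) ^+ r.+1 * f 0%N t.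
Proof.
move=> ch fb fr t ta tb ts.
pose P i x : R := (x - b) ^+ (r - i) / (r - i)`!%:R.
have chP : chain a b s r P.
  move=> i ir; split.
    exact/continuous_subspaceT/continuous_monomial.
  by move=> x _ _ _; rewrite /P -subnSK//; exact: is_derive_monomial.
have := chain_lin (-1) (- c) ch chP; set F := fun _ _ => _ => chF.
have : 0 <= (-1) ^+ (\sum_(0 <= j < r) ~~ false)%N * F 0%N t.
  apply: (sign_of_boundary_problem (A := fun=> false) (B := fun=> true) chF) => //.
  - move=> i ir _; rewrite /F fb// mulr0 add0r /P subrr expr0n subn_eq0 leqNgt ir/=.
    by rewrite mul0r mulr0.
  - by move=> i ir; rewrite sum_nat_const_nat muln1.
  - by rewrite sum_nat_const_nat subn0 muln1.
  - move=> x xa xb xs; rewrite /F /P subnn expr0 fact0 divr1 mulr1 mulN1r.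
    by have := fr x xa xb xs; lra.
rewrite sum_nat_const_nat subn0 muln1 /F.
rewrite /P subn0 => H.
have E : (t - b) ^+ r = (-1) ^+ r * (b - t) ^+ r by rewrite -exprMn mulN1r opprB.
rewrite -subr_ge0; move: H; rewrite E exprS.
have : (-1) ^+ r * (-1) ^+ r = 1 :> R by rewrite -expr2 sqrr_sign.
move: ((-1) ^+ r) (r`!%:R^-1) ((b - t) ^+ r) => e v u ee.
suff -> : e * (-1 * f 0%N t + - c * (e * u * v)) = -1 * e * f 0%N t - c * (u * v) by [].
by transitivity (-1 * e * f 0%N t - c * (u * v) * (e * e)); [ring|rewrite ee mulr1].
Qed.

Lemma integrate_from_right_bound a b s r c f :
  chain a b s r f -> (forall i, (i < r)%N -> f i b = 0) ->
  (forall t, a < t -> t < b -> t != s -> `|f r t| <= c) ->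
  forall t, a < t -> t < b -> t != s -> `|f 0%N t| <= c * ((b - t) ^+ r / r`!%:R).
Proof.
move=> ch fb fr t ta tb ts.
(* Only e = 1 and e = -1 are used; an absolute bound by c is a one-sided bound for both f and -f. *)
have bound e : e * e = 1 ->
    - c * ((b - t) ^+ r / r`!%:R) <= (-1) ^+ r.+1 * (e * f 0%N t).
  move=> ee; have := integrate_from_right (c := - c) (chain_lin e 0 ch ch).
  move=> /(_ _ _ t ta tb ts); rewrite mul0r addr0; apply.
    by move=> i ir; rewrite fb// !mulr0 addr0.
  move=> x xa xb xs; rewrite mul0r addr0 opprK (le_trans (ler_norm _))// normrM.
  have -> : `|e| = 1.
    have : `|e| ^+ 2 = 1 by rewrite -normrX expr2 ee normr1.
    by move/eqP; rewrite -[X in _ == X](expr1n _ 2) eqrXn2// => /eqP.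
  by rewrite mul1r; exact: fr.
have := bound 1 (mulr1 1); rewrite mul1r => b1.
have b2 : - c * ((b - t) ^+ r / r`!%:R) <= - ((-1) ^+ r.+1 * f 0%N t).
  have := bound (-1); rewrite mulrNN mulr1 mulN1r mulrN; exact.
have <- : `|(-1) ^+ r.+1 * f 0%N t| = `|f 0%N t| by rewrite normrM normr_sign mul1r.
rewrite ler_norml; apply/andP; split; first by rewrite -mulNr.
by rewrite -lerN2 -mulNr.
Qed.

Lemma derive_zero_on (u v d t : R) (g : R -> R) : (forall x, u < x -> x < v -> g x = 0) ->
  u < t -> t < v -> is_derive t 1 g d -> d = 0.
Proof.
move=> g0 ut tv dg; have d0 : is_derive t 1 (cst 0 : R -> R) (0 : R) by exact: is_derive_cst.
have : is_derive t 1 (cst 0 : R -> R) d.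
  have tuv : t \in `]u, v[%R by rewrite in_itv/= ut tv.
  apply: near_eq_is_derive dg; apply: filterS (near_in_itvoo tuv) => x.
  by rewrite in_itv/= => /andP[ux xv]; rewrite g0.
by move=> d1; have <- := @derive_val _ _ _ _ _ _ _ d1; rewrite derive_cst.
Qed.

Lemma zero_closure (u v : R) (g : R -> R) : u < v -> {within `[u, v], continuous g} ->
  (forall x, u < x -> x < v -> g x = 0) -> forall t, u <= t -> t <= v -> g t = 0.
Proof.
move=> uv cg g0 t ut tv.
have cNg : {within `[u, v], continuous (fun x => - g x)}.
  by move=> x; apply: cvgN; exact: cg.
have := @ge0_itv_closure R u v u g uv cg _ t ut tv.
have := @ge0_itv_closure R u v u _ uv cNg _ t ut tv; rewrite oppr_ge0 => l l'.
apply/eqP; rewrite eq_le l ?l'// => x ux xv _; by rewrite g0// oppr0.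
Qed.

End ChainCalculus.

(** * Comparison with a solution having unit datum at b *)

Section Comparison.
Context {R : realType}.
Variables (a b : R) (n q : nat) (A B : nat -> bool).
Hypotheses (ab : a < b) (q_gt0 : (0 < q)%N) (q_lt : (q < n)%N).
Hypothesis A_lt : forall i, A i -> (i < q)%N.
Hypothesis B_ge : forall i, (q <= i < n)%N -> B i.
Hypothesis tails :
  forall i, (i <= q)%N -> (\sum_(i <= j < q) (A j + B j) <= q - i)%N.
Hypothesis total : (\sum_(0 <= j < q) (A j + B j))%N = q.
Implicit Types (s t x c m M : R) (f y z u h : nat -> R -> R).

(** [nu] is the sign produced by n - q integrations from b. [w] adds one factor -1 for each order
    below q without a condition at a, so it relates the sign of order n to that of order 0; in the
    theorem it equals (-1)^(n-k). *)
Let nu : R := (-1) ^+ (n - q).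
Let w : R := (-1) ^+ (\sum_(0 <= j < q) ~~ A j + (n - q))%N.
Let r : nat := (n.-1 - q)%N.

(** The cut-off [N] makes room for functions that satisfy all conditions except the one of order n-1
    at b, where the comparison function has the datum -1. *)
Definition conditions N f :=
  (forall i, (i < N)%N -> A i -> f i a = 0) /\
  (forall i, (i < N)%N -> B i -> f i b = 0).

Lemma conditions_lin N c d f h : conditions N f -> conditions N h ->
  conditions N (fun i t => c * f i t + d * h i t).
Proof.
move=> [fa fb] [ha hb]; split=> i iN Ci; first by rewrite fa// ha// !mulr0 addr0.
by rewrite fb// hb// !mulr0 addr0.
Qed.

Lemma conditions_le N N' f : (N' <= N)%N -> conditions N f -> conditions N' f.
Proof.
by move=> NN [fa fb]; split=> i iN; [apply: fa|apply: fb]; exact: leq_trans NN.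
Qed.

Let n_prednK : n.-1.+1 = n. Proof. by rewrite prednK//; exact: leq_trans q_lt. Qed.

Let n1 : (n.-1 < n)%N. Proof. by rewrite n_prednK. Qed.

Let n_pred : n.-1 = (q + r)%N. Proof. by rewrite subnKC// -ltnS n_prednK. Qed.

Let r_index i : (i < r)%N -> (q <= q + i < n)%N.
Proof. by move=> ir; rewrite leq_addr/= -n_prednK ltnS n_pred leq_add2l ltnW. Qed.

Lemma sign_from_q s f : chain a b s n.-1 f -> conditions n.-1 f ->
  (forall t, a < t -> t < b -> t != s -> 0 <= nu * f q t) ->
  forall t, a <= t -> t <= b -> 0 <= w * f 0%N t.
Proof.
move=> ch [fa fb] fq.
have chq : chain a b s q (fun i t => nu * f i t + 0 * f i t).
  apply: chain_lin; apply: chain_weaken ch => //; lia.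
have H t : a < t -> t < b -> t != s -> 0 <= w * f 0%N t.
  move=> ta tb ts.
  have -> : w * f 0%N t = (-1) ^+ (\sum_(0 <= j < q) ~~ A j)%N * (nu * f 0%N t + 0 * f 0%N t).
    by rewrite mul0r addr0 mulrA -exprD.
  apply: (sign_of_boundary_problem (A := A) (B := B) chq) => //.
  - by move=> i iq Ai; rewrite fa ?mulr0 ?addr0//; lia.
  - by move=> i iq Bi; rewrite fb ?mulr0 ?addr0//; lia.
  - by move=> x xa xb xs; rewrite mul0r addr0; exact: fq.
apply: (@ge0_itv_closure R a b s) => //.
have q1 : (0 < n.-1)%N by lia.
have [/= cw _] := chain_lin w 0 ch ch q1.
suff -> : (fun t => w * f 0%N t) = (fun t => w * f 0%N t + 0 * f 0%N t) by [].
by apply/funext => x; rewrite mul0r addr0.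
Qed.

Let shifted s f : chain a b s n.-1 f -> chain a b s r (fun i => f (q + i)%N).
Proof. by rewrite n_pred => ch; exact: chain_shift. Qed.

Let nuE : nu = (-1) ^+ r.+1. Proof. by rewrite /nu /r -subSn ?n_prednK// -ltnS n_prednK. Qed.

Lemma lower_from_top s c f : chain a b s n.-1 f -> conditions n.-1 f ->
  (forall t, a < t -> t < b -> t != s -> f n.-1 t <= - c) ->
  forall t, a < t -> t < b -> t != s -> c * ((b - t) ^+ r / r`!%:R) <= nu * f q t.
Proof.
move=> ch [_ fb] fn t ta tb ts; rewrite nuE -[in f q](addn0 q).
apply: (integrate_from_right (shifted ch)) => // [i ir|x xa xb xs].
  by apply: fb; rewrite ?n_pred ?ltn_add2l//; exact/B_ge/r_index.
by rewrite -n_pred; exact: fn.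
Qed.

Lemma bound_from_top s c f : chain a b s n.-1 f -> conditions n.-1 f ->
  (forall t, a < t -> t < b -> t != s -> `|f n.-1 t| <= c) ->
  forall t, a < t -> t < b -> t != s -> `|f q t| <= c * ((b - t) ^+ r / r`!%:R).
Proof.
move=> ch [_ fb] fn t ta tb ts; rewrite -[in f q](addn0 q).
apply: (integrate_from_right_bound (shifted ch)) => // [i ir|x xa xb xs].
  by apply: fb; rewrite ?n_pred ?ltn_add2l//; exact/B_ge/r_index.
by rewrite -n_pred; exact: fn.
Qed.

Lemma geometric_limit_ge0 (C x Y Z : R) : 0 <= x < 1 ->
  (forall j : nat, 0 <= C * x ^+ j * Y + Z) -> 0 <= Z.
Proof.
move=> /andP[x0 x1] H.
have cv : C * x ^+ j * Y + Z @[j --> \oo] --> C * 0 * Y + Z.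
  apply: cvgD; last exact: cvg_cst.
  apply: cvgM; last exact: cvg_cst.
  apply: cvgM; first exact: cvg_cst.
  by apply: cvg_expr; rewrite ger0_norm.
have -> : Z = C * 0 * Y + Z by rewrite mulr0 mul0r add0r.
rewrite -(cvg_lim _ cv)//; apply: limr_ge; first by apply/cvg_ex; eexists; exact: cv.
by near=> j; exact: H.
Unshelve. all: by end_near. Qed.

(* Writing [nu z_q >= - c nu y_q], the hypotheses improve the constant [c] by a
   fixed factor less than 1, so that it can be taken to be 0. *)
Lemma comparison s y z (C C' : R) :
  chain a b s n.-1 y -> conditions n.-1 y ->
  chain a b s n.-1 z -> conditions n.-1 z ->
  (forall t, a < t -> t < b -> t != s -> `|y n.-1 t| <= C) ->
  (forall t, a < t -> t < b -> t != s -> `|z n.-1 t| <= C') ->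
  (forall t, a < t -> t < b -> t != s -> (b - t) ^+ r / r`!%:R <= nu * y q t) ->
  (forall c, 0 <= c ->
    (forall t, a <= t -> t <= b -> 0 <= w * (c * y 0%N t + z 0%N t)) ->
    forall t, a < t -> t < b -> t != s -> c * y n.-1 t + z n.-1 t <= - c) ->
  forall t, a < t -> t < b -> t != s -> 0 <= nu * z q t.
Proof.
move=> chy cy chz cz yC zC yL step.
(* The maximum with 1 makes 1 - 1/D a ratio in [0, 1). *)
pose D := Num.max C 1; have D1 : 1 <= D by rewrite le_max lexx orbT.
have D0 : 0 < D by rewrite (lt_le_trans _ D1).
have yD := bound_from_top chy cy (c := D).
have {}yD t : a < t -> t < b -> t != s -> `|y q t| <= D * ((b - t) ^+ r / r`!%:R).
  by apply: yD => x xa xb xs; rewrite (le_trans (yC x xa xb xs))// le_max lexx.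
have norm_nu x : `|nu * x| = `|x| by rewrite normrM normr_sign mul1r.
(* If c y + z has the right sign at order q, then [step] puts its order n-1 below -c, and
   integration bounds order q from below by c times the weight. The weight is at least nu y_q / D,
   so this share of c y can be given up. *)
have improve c : 0 <= c ->
    (forall t, a < t -> t < b -> t != s -> 0 <= c * (nu * y q t) + nu * z q t) ->
    forall t, a < t -> t < b -> t != s ->
      0 <= c * (1 - D^-1) * (nu * y q t) + nu * z q t.
  move=> c0 H.
  have chH := chain_lin c 1 chy chz; have cH := conditions_lin c 1 cy cz.
  have wH := sign_from_q chH cH.
  have {}wH t : a <= t -> t <= b -> 0 <= w * (c * y 0%N t + z 0%N t).
    move=> ta tb; rewrite -[z 0%N t]mul1r; apply: wH => // x xa xb xs.
    by have := H x xa xb xs; congr (_ <= _); ring.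
  have top := step c c0 wH.
  have low := lower_from_top (c := c) chH cH.
  move=> t ta tb ts; have {}low := low _ t ta tb ts.
  have {}low : c * ((b - t) ^+ r / r`!%:R) <= c * (nu * y q t) + nu * z q t.
    have -> : c * (nu * y q t) + nu * z q t = nu * (c * y q t + 1 * z q t) by ring.
    by apply: low => x xa xb xs; rewrite mul1r; exact: top.
  have ubd : c * D^-1 * (nu * y q t) <= c * ((b - t) ^+ r / r`!%:R).
    rewrite -mulrA ler_wpM2l// ler_pdivrMl//.
    by rewrite (le_trans (ler_norm _))// norm_nu; exact: yD.
  by move: (le_trans ubd low); rewrite -subr_ge0; congr (_ <= _); ring.
(* Starting constant: |z_q| is at most E times the weight, and the weight is at most nu y_q. *)
pose E := Num.max C' 0; have E0 : 0 <= E by rewrite le_max lexx orbT.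
have base t : a < t -> t < b -> t != s -> 0 <= E * (nu * y q t) + nu * z q t.
  move=> ta tb ts.
  have zE : `|nu * z q t| <= E * ((b - t) ^+ r / r`!%:R).
    rewrite norm_nu; apply: (bound_from_top chz cz) => // x xa xb xs.
    by rewrite (le_trans (zC x xa xb xs))// le_max lexx.
  have : E * ((b - t) ^+ r / r`!%:R) <= E * (nu * y q t).
    by rewrite ler_wpM2l//; exact: yL.
  by move: zE; rewrite ler_norml => /andP[]; lra.
move=> t ta tb ts.
have Dv : 0 <= 1 - D^-1 < 1.
  by rewrite subr_ge0 invf_le1// D1/= ltrBlDr ltrDl invr_gt0.
apply: (geometric_limit_ge0 (C := E) (Y := nu * y q t) Dv) => j.
elim: j t ta tb ts => [|j IH] t ta tb ts; first by rewrite expr0 mulr1; exact: base.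
have /andP[Dv0 _] := Dv.
rewrite exprSr [E * _]mulrA; apply: improve => //.
by rewrite mulr_ge0// exprn_ge0.
Qed.

(** Nonnegativity improves itself: w y >= 0 makes y^(n) nonnegative, so y^(n-1) stays below its
    final value -1, and integrating from b yields the explicit lower bound. *)
Lemma solution_lower m y : 0 <= m -> chain a b b n y -> conditions n.-1 y ->
  y n.-1 b = -1 ->
  (forall t, a < t -> t < b -> y n t = w * m * y 0%N t) ->
  (forall t, a < t -> t < b -> 0 <= nu * y q t) ->
  [/\ forall t, a <= t -> t <= b -> 0 <= w * y 0%N t,
      forall t, a < t -> t < b -> y n.-1 t <= -1 &
      forall t, a < t -> t < b -> (b - t) ^+ r / r`!%:R <= nu * y q t].
Proof.
move=> m0 ch cy yb yn yq.
have ch' : chain a b b n.-1 y by apply: chain_weaken ch => //; lia.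
have w0 : forall t, a <= t -> t <= b -> 0 <= w * y 0%N t.
  by apply: (sign_from_q ch' cy) => t ta tb _; exact: yq.
have top t : a < t -> t < b -> y n.-1 t <= -1.
  move=> ta tb; rewrite -yb; have [cn dn] := ch n.-1 n1.
  apply: (le_of_derive_ge0 cn dn) => //; [|exact: ltW..].
  move=> x xa xb _; rewrite n_prednK yn//.
  by rewrite mulrAC mulr_ge0// w0// ltW.
split => // t ta tb; rewrite -[X in X <= _]mul1r.
by apply: (lower_from_top (s := b) ch' cy) => //; [move=> x xa xb _; exact: top|rewrite lt_eqF].
Qed.

(** The comparison applies to u and to -u, which forces u^(q) = 0. The condition u^(n-1)(b) = 0 is
    what makes c y + e u end at -c in order n-1. *)
Lemma eigenfunction_eq0 m mu y u : 0 <= mu -> mu <= m ->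
  chain a b b n y -> conditions n.-1 y -> y n.-1 b = -1 ->
  (forall t, a < t -> t < b -> y n t = w * m * y 0%N t) ->
  (forall t, a < t -> t < b -> 0 <= nu * y q t) ->
  chain a b b n u -> conditions n u ->
  (forall t, a < t -> t < b -> u n t = w * mu * u 0%N t) ->
  forall t, a <= t -> t <= b -> u 0%N t = 0.
Proof.
move=> mu0 mum chy cy yb yn yq chu cu un.
have m0 := le_trans mu0 mum.
have [wy0 _ yL] := solution_lower m0 chy cy yb yn yq.
have weak f : chain a b b n f -> chain a b b n.-1 f.
  by apply: chain_weaken => //; lia.
have [C _ yC] := bounded_within (chy _ n1).1.
have [C' _ uC] := bounded_within (chu _ n1).1.
have ub : u n.-1 b = 0 by apply: cu.2 => //; apply: B_ge; lia.
have onesided e : `|e| = 1 -> forall t, a < t -> t < b -> 0 <= nu * (e * u q t + 0 * u q t).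
  move=> e1 t ta tb.
  apply: (@comparison b y (fun i x => e * u i x + 0 * u i x) C C') => //.
  - exact: weak.
  - by apply: chain_lin; exact: weak.
  - by apply: conditions_lin; apply: conditions_le cu; lia.
  - by move=> x xa xb _; apply: yC; exact: ltW.
  - by move=> x xa xb _; rewrite mul0r addr0 normrM e1 mul1r; apply: uC; exact: ltW.
  - by move=> x xa xb _; exact: yL.
  - move=> c c0 H x xa xb _.
    have chH := chain_lin c e chy chu.
    have [cn dn] := chH _ n1.
    have Hb : c * y n.-1 b + e * u n.-1 b = - c by rewrite yb ub; ring.
    rewrite mul0r addr0 -Hb; apply: (le_of_derive_ge0 cn dn) => //; [|exact: ltW..].
    move=> v va vb _; rewrite n_prednK yn// un//.
    have := H v (ltW va) (ltW vb); rewrite mul0r addr0 => Hv.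
    have := wy0 v (ltW va) (ltW vb) => yv.
    (* Both terms are nonnegative; the second one is where mu <= m enters. *)
    have -> : c * (w * m * y 0%N v) + e * (w * mu * u 0%N v) =
      mu * (w * (c * y 0%N v + e * u 0%N v)) + (m - mu) * (c * (w * y 0%N v)) by ring.
    by apply: addr_ge0; apply: mulr_ge0 => //; [rewrite subr_ge0|exact: mulr_ge0].
  - by rewrite lt_eqF.
have uq t : a < t -> t < b -> u q t = 0.
  move=> ta tb; have := onesided 1 (normr1 _) t ta tb.
  have := onesided (-1) (normrN1 _) t ta tb; rewrite mul0r !addr0 mul1r mulN1r mulrN.
  rewrite oppr_ge0 => l g; apply/eqP; have := le_anti (introT andP (conj l g)).
  by move/eqP; rewrite mulf_eq0 signr_eq0.
have cu' : conditions n.-1 u by apply: conditions_le cu; lia.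
(* Once u^(q) vanishes, the sign lemma bounds both u and -u, so u = 0. *)
have sgn e : forall t, a <= t -> t <= b -> 0 <= w * (e * u 0%N t + 0 * u 0%N t).
  apply: (@sign_from_q b (fun i x => e * u i x + 0 * u i x)).
  - by apply: chain_lin; exact: weak.
  - exact: conditions_lin.
  - by move=> x xa xb _; rewrite uq// !mulr0 addr0 mulr0.
move=> t ta tb; have := sgn 1 t ta tb; have := sgn (-1) t ta tb.
rewrite mul0r !addr0 mul1r mulN1r mulrN.
rewrite oppr_ge0 => l g; apply/eqP; have := le_anti (introT andP (conj l g)).
by move/eqP; rewrite mulf_eq0 signr_eq0.
Qed.

(** [zl] and [zr] are the smooth continuations of the two branches of the Green's function; they
    allow monotonicity of order n-1 to be used up to [s] from either side. *)
Lemma green_positive m y s zl zr z : 0 <= m ->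
  chain a b b n y -> conditions n.-1 y -> y n.-1 b = -1 ->
  (forall t, a < t -> t < b -> y n t = w * m * y 0%N t) ->
  (forall t, a < t -> t < b -> 0 <= nu * y q t) ->
  a <= s -> s <= b ->
  chain a b s n.-1 z -> conditions n.-1 z ->
  chain a b b n zl -> chain a b b n zr ->
  (forall i t, t < s -> z i t = zl i t) -> (forall i t, s < t -> z i t = zr i t) ->
  (forall t, a < t -> t < b -> zl n t = w * m * zl 0%N t) ->
  (forall t, a < t -> t < b -> zr n t = w * m * zr 0%N t) ->
  zr n.-1 b = 0 -> zl n.-1 s = zr n.-1 s - 1 ->
  forall t, a < t -> t < b -> t != s -> 0 <= nu * z q t.
Proof.
move=> m0 chy cy yb yn yq as_ sb chz cz chl chr zl_ zr_ ln rn rb lr.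
have [wy0 _ yL] := solution_lower m0 chy cy yb yn yq.
have [C _ yC] := bounded_within (chy _ n1).1.
have [C1 C1_0 lC] := bounded_within (chl _ n1).1.
have [C2 C2_0 rC] := bounded_within (chr _ n1).1.
apply: (@comparison s y z C (C1 + C2)) => //.
- by apply: chain_weaken chy => //; [lia|move=> t _ tb _; rewrite lt_eqF].
- by move=> x xa xb _; apply: yC; exact: ltW.
- move=> x xa xb; rewrite neq_lt => /orP[xs|xs].
    by rewrite zl_// (le_trans (lC x _ _)) ?lerDl ?ltW.
  by rewrite zr_// (le_trans (rC x _ _)) ?lerDr ?ltW.
- by move=> x xa xb _; exact: yL.
move=> c c0 H.
have chL := chain_lin c 1 chy chl; have chR := chain_lin c 1 chy chr.
have Rle x : s <= x -> x <= b -> c * y n.-1 x + 1 * zr n.-1 x <= - c.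
  move=> sx xb; have [cn dn] := chR _ n1.
  have <- : c * y n.-1 b + 1 * zr n.-1 b = - c by rewrite yb rb; ring.
  apply: (@le_of_derive_ge0 R s b b _
    (fun t => c * y n.-1.+1 t + 1 * zr n.-1.+1 t) x b (within_itv_sub as_ (lexx b) cn)) => //.
    by move=> t ta; apply: dn; exact: le_lt_trans ta.
  move=> t ta tb _; have ta' := le_lt_trans as_ ta; rewrite n_prednK yn// rn//.
  have := H t (ltW (le_lt_trans as_ ta)) (ltW tb); rewrite zr_// => Ht.
  have -> : c * (w * m * y 0%N t) + 1 * (w * m * zr 0%N t) =
    m * (w * (c * y 0%N t + zr 0%N t)) by ring.
  exact: mulr_ge0.
move=> x xa xb; rewrite neq_lt => /orP[xs|xs]; last first.
  by rewrite zr_//; have := Rle x (ltW xs) (ltW xb); rewrite mul1r.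
(* To the left of [s] order n-1 increases towards its left limit at [s], which the jump places one
   unit below the right one, hence below -c. *)
rewrite zl_//; have := Rle s (lexx s) sb.
suff : c * y n.-1 x + 1 * zl n.-1 x <= c * y n.-1 s + 1 * zl n.-1 s by rewrite lr; lra.
have [cn dn] := chL _ n1.
apply: (@le_of_derive_ge0 R a s s _
  (fun t => c * y n.-1.+1 t + 1 * zl n.-1.+1 t) x s (within_itv_sub (lexx a) sb cn)) => //;
  try exact: ltW.
  move=> t ta tb _; apply: dn => //; [exact: lt_le_trans sb|].
  by rewrite lt_eqF//; exact: lt_le_trans sb.
move=> t ta tb _; have tb' := lt_le_trans tb sb; rewrite n_prednK yn// ln//.
have := H t (ltW ta) (ltW tb'); rewrite zl_// => Ht.
have -> : c * (w * m * y 0%N t) + 1 * (w * m * zl 0%N t) =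
  m * (w * (c * y 0%N t + zl 0%N t)) by ring.
exact: mulr_ge0.
Qed.


Lemma wrong_sign_green m s h i0 (lp lm : R) : 0 < m -> a < s -> s < b -> A i0 ->
  chain a b s n.-1 h -> conditions n.-1 h ->
  (forall t, a < t -> t < b -> t != s -> is_derive t 1 (h n.-1) (h n t)) ->
  (forall x, s < x -> x < b -> {within `[x, b], continuous (h n.-1)}) ->
  h n.-1 b = 0 ->
  (forall t, a < t -> t < b -> t != s -> h n t = - (w * m * h 0%N t)) ->
  h n.-1 t @[t --> s^'+] --> lp -> h n.-1 t @[t --> s^'-] --> lm -> lp - lm = 1 ->
  (forall t, a < t -> t < b -> t != s -> 0 <= nu * h q t) -> False.
Proof.
move=> m0 as_ sb Ai0 ch cond dtop ctop hb hn clp clm jump hq.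
have wh0 := sign_from_q ch cond hq.
have der i t : (i < n)%N -> a < t -> t < b -> t != s -> is_derive t 1 (h i) (h i.+1 t).
  move=> ni ta tb ts; have [lt|] := ltnP i n.-1; first exact: (ch i lt).2.
  move=> ge; have -> : i = n.-1 by lia.
  by rewrite n_prednK; exact: dtop.
have spread (u v : R) i j : a <= u -> v <= b -> (forall t, u < t -> t < v -> t != s) ->
    (i <= j <= n)%N ->
    (forall t, u < t -> t < v -> h i t = 0) -> forall t, u < t -> t < v -> h j t = 0.
  move=> au vb uvs /andP[ij jn] hi; elim: j ij jn => [|j IH].
    by rewrite leqn0 => /eqP <-.
  rewrite leq_eqVlt => /predU1P[<-//|ij] jn t ut tv.
  apply: (derive_zero_on (IH ij (ltnW jn)) ut tv).
  by apply: der => //; [exact: le_lt_trans ut|exact: lt_le_trans vb|exact: uvs].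
(* To the right of [s], w h >= 0 gives h^(n) <= 0, with zero data at b in all orders from q to n-1.
   The n - q integrations produce the sign opposite to [hq]. *)
have q0 t : s < t -> t < b -> h q t = 0.
  move=> st tb; pose x := (s + t) / 2.
  have [sx xt] : s < x /\ x < t by rewrite /x; split; lra.
  have ax : a <= x by rewrite ltW// (lt_trans as_).
  have chx : chain x b b r.+1 (fun i => h (q + i)%N).
    move=> i ir; split.
      have [i_lt|i_ge] := ltnP (q + i) n.-1.
        by apply: within_itv_sub (ch _ i_lt).1.
      have -> : (q + i = n.-1)%N by rewrite n_pred in i_ge *; lia.
      by apply: ctop => //; exact: lt_trans tb.
    move=> v xv vb _; rewrite addnS; apply: der => //.
    - by rewrite -n_prednK n_pred ltnS; lia.
    - exact: le_lt_trans xv.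
    - by rewrite gt_eqF// (lt_trans sx).
  have : 0 <= - nu * h q t.
    have -> : - nu * h q t = (-1) ^+ r.+2 * h (q + 0)%N t.
      by rewrite addn0 exprS -nuE mulN1r.
    rewrite -[X in X <= _](mul0r ((b - t) ^+ r.+1 / r.+1`!%:R)).
    apply: (integrate_from_right chx) => //.
    - move=> i; rewrite ltnS leq_eqVlt => /predU1P[->|ir]; first by rewrite -n_pred.
      by apply: cond.2; [rewrite n_pred; lia|apply: B_ge; rewrite /r in ir; lia].
    - move=> v xv vb _; rewrite addnS -n_pred n_prednK hn//.
      + rewrite oppr0 oppr_le0 mulrAC mulr_ge0 ?(ltW m0)// wh0 ?ltW//.
        exact: le_lt_trans xv.
      + exact: le_lt_trans xv.
      + by rewrite gt_eqF// (lt_trans sx).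
    - by rewrite lt_eqF.
  have ta := lt_trans as_ st.
  have := hq t ta tb; rewrite gt_eqF// => /(_ isT) l.
  rewrite mulNr oppr_ge0 => g; have := le_anti (introT andP (conj g l)).
  by move/eqP; rewrite mulf_eq0 signr_eq0 => /eqP.
have sbs t : s < t -> t < b -> t != s by move=> st _; rewrite gt_eqF.
have ass t : a < t -> t < s -> t != s by move=> _ st; rewrite lt_eqF.
(* h^(q) = 0 gives h^(n) = 0, and the equation with m > 0 returns h = 0. *)
have h0 t : s < t -> t < b -> h 0%N t = 0.
  move=> st tb; have := spread s b q n (ltW as_) (lexx b) sbs _ q0 t st tb.
  rewrite hn ?sbs//; last exact: lt_trans st.
  move=> /(_ _)/wrap[|/eqP]; first by rewrite leqnn andbT ltnW.
  by rewrite oppr_eq0 !mulf_eq0 signr_eq0 gt_eqF//= => /eqP.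
have hi i t : (i <= n)%N -> s < t -> t < b -> h i t = 0.
  by move=> ni; apply: (spread s b 0%N) => //; exact: ltW.
have his i : (i < n.-1)%N -> h i s = 0.
  move=> ni; apply: (zero_closure sb (within_itv_sub (ltW as_) (lexx b) (ch i ni).1)) => //.
    by move=> x; apply: hi; lia.
  exact: ltW.
have lp0 : lp = 0.
  apply: (cvg_unique _ clp); first exact: norm_hausdorff.
  apply: cvg_near_cst; near=> t; apply: hi; first exact: leq_pred.
    by near: t; exact: nbhs_right_gt.
  by near: t; exact: nbhs_right_lt.
have i0q := A_lt Ai0.
pose d := (q - i0)%N; have dE : (i0 + d = q)%N by rewrite /d; lia.
have chd : chain a s s d (fun i t => nu * h (i0 + i)%N t + 0 * h (i0 + i)%N t).
  by apply: chain_lin; apply: chain_shift; rewrite dE; apply: chain_weaken ch => //;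
    try lia; exact: ltW.
have top t : a < t -> t < s -> t != s -> 0 <= nu * h (i0 + d)%N t + 0 * h (i0 + d)%N t.
  move=> ta ts tns; rewrite mul0r addr0 dE; apply: hq => //; exact: lt_trans sb.
have s0 i : (i < d)%N -> nu * h (i0 + i)%N s + 0 * h (i0 + i)%N s = 0.
  by move=> id; rewrite his ?mulr0 ?addr0//; lia.
(* On (a, s), the zero data at [s] determine a sign of h^(i0). Exchanging the datum of order i0 at
   [s] for the one at a lowers the number of orders without a condition at a by one, which gives the
   opposite sign as well. *)
have left0 t : a < t -> t < s -> h i0 t = 0.
  move=> ta ts; have tns := ass t ta ts.
  have : 0 <= (-1) ^+ (\sum_(0 <= j < d) ~~ false)%N *
      (nu * h (i0 + 0)%N t + 0 * h (i0 + 0)%N t).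
    apply: (sign_of_boundary_problem (A := fun=> false) (B := fun=> true) chd) => //.
    - by move=> i id _; exact: s0.
    - by move=> i id; rewrite sum_nat_const_nat muln1.
    - by rewrite sum_nat_const_nat subn0 muln1.
  have sumd i : (i <= d)%N -> (\sum_(i <= j < d) ((j == 0%N) + (j != 0%N)) = d - i)%N.
    move=> id; under eq_bigr do (rewrite (_ : (_ + _)%N = 1%N); last by case: (_ == _)).
    by rewrite sum_nat_const_nat muln1.
  have : 0 <= (-1) ^+ (\sum_(0 <= j < d) ~~ (j == 0))%N *
      (nu * h (i0 + 0)%N t + 0 * h (i0 + 0)%N t).
    apply: (sign_of_boundary_problem (A := fun j => j == 0%N) (B := fun j => j != 0%N) chd) => //.
    - move=> i id /eqP ->; rewrite addn0 cond.1//; [by rewrite !mulr0 addr0|lia].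
    - by move=> i id _; exact: s0.
    - by move=> i id; rewrite sumd.
    - by rewrite sumd// subn0.
  have [d' d'E] : exists d', d = d'.+1 by exists d.-1; rewrite /d; lia.
  rewrite d'E sum_nat_const_nat subn0 muln1 big_ltn// big_nat.
  under eq_bigr => j /andP[j0 _] do rewrite -lt0n j0.
  rewrite -big_nat sum_nat_const_nat muln1 /= add0n subn1 /= addn0 mul0r addr0.
  rewrite exprS mulN1r mulNr oppr_ge0 => l g.
  have := le_anti (introT andP (conj g l)).
  by move/eqP; rewrite !mulf_eq0 !signr_eq0 => /eqP.
have lm0 : lm = 0.
  apply: (cvg_unique _ clm); first exact: norm_hausdorff.
  apply: cvg_near_cst; near=> t; apply: (spread a s i0 n.-1 (lexx a) (ltW sb) ass _ left0).
  - by rewrite leq_pred andbT -ltnS n_prednK (ltn_trans i0q).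
  - by near: t; exact: nbhs_left_gt.
  - by near: t; exact: nbhs_left_lt.
by move: jump; rewrite lp0 lm0 subrr => /eqP; rewrite eq_sym oner_eq0.
Unshelve. all: by end_near. Qed.

End Comparison.

(** * Derivatives relative to a compact interval *)

Section WithinDerivative.
Context {R : realType}.
Implicit Types (a b s t x l d : R) (f g : R -> R).

Lemma cvg_diffq_withinP a b f t l :
  diffq_within a b f t --> l <->
  forall e, 0 < e -> exists2 d, 0 < d & forall x, a <= x -> x <= b -> x != t ->
    `|x - t| < d -> `|l - (f x - f t) / (x - t)| < e.
Proof.
rewrite /diffq_within; split => [/cvgrPdist_lt H e e0|H].
  have := H e e0; rewrite near_withinE near_withinE => /nbhs_ballP[d /= d0 Hd].
  exists d => // x ax xb xt xd; apply: Hd => //=; first by rewrite /ball/= distrC.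
  by rewrite in_itv/= ax xb.
apply/cvgrPdist_lt => e /H[d d0 Hd]; rewrite near_withinE near_withinE.
apply/nbhs_ballP; exists d => //= x; rewrite /ball/= distrC => xd xt.
by rewrite in_itv/= => /andP[ax xb]; exact: Hd.
Qed.

Lemma is_deriveP f t l :
  is_derive t 1 f l <->
  forall e, 0 < e -> exists2 d, 0 < d & forall x, x != t ->
    `|x - t| < d -> `|l - (f x - f t) / (x - t)| < e.
Proof.
have E : (forall e, 0 < e -> exists2 d, 0 < d & forall x, x != t ->
      `|x - t| < d -> `|l - (f x - f t) / (x - t)| < e) <->
    (fun h : R => h^-1 *: ((f \o shift t) (h *: 1) - f t)) @ 0^' --> l.
  split => [H|/cvgrPdist_lt H e e0].
    apply/cvgrPdist_lt => e /H[d d0 Hd]; rewrite near_withinE.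
    apply/nbhs_ballP; exists d => //= h; rewrite /ball/= sub0r normrN => hd h0.
    have := Hd (h + t); rewrite addrK -subr_eq0 addrK => /(_ h0 hd).
    by rewrite /GRing.scale/= mulr1 mulrC.
  have := H e e0; rewrite near_withinE => /nbhs_ballP[d /= d0 Hd].
  exists d => // x xt xd; have := Hd (x - t).
  rewrite /ball/= sub0r normrN subr_eq0 => /(_ xd xt).
  by rewrite /GRing.scale/= mulr1 subrK mulrC.
split => [[df dl]|/E H].
  by apply/E; rewrite -dl; exact: df.
by apply: DeriveDef; [apply/cvg_ex; exists l|exact: cvg_lim H].
Qed.

Lemma is_derive_diffq a b f t l : is_derive t 1 f l -> diffq_within a b f t --> l.
Proof.
move=> /is_deriveP H; apply/cvg_diffq_withinP => e /H[d d0 Hd].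
by exists d => // x _ _; exact: Hd.
Qed.

Lemma diffq_is_derive a b f t l : a < t -> t < b ->
  diffq_within a b f t --> l -> is_derive t 1 f l.
Proof.
move=> ta tb /cvg_diffq_withinP H; apply/is_deriveP => e /H[d d0 Hd].
exists (Num.min d (Num.min (t - a) (b - t))); first by rewrite !lt_min d0 !subr_gt0 ta.
move=> x xt; rewrite !lt_min => /and3P[xd].
by move=> /ltr_normlP[xa _] /ltr_normlP[_ xb]; apply: Hd => //; lra.
Qed.

(** Makes the limits in [derive_within] unique, at the two endpoints too. *)
Lemma within_punctured_proper a b t : a < b -> a <= t -> t <= b ->
  ProperFilter (within `[a, b] t^').
Proof.
move=> ab ta tb; apply: Build_ProperFilter_ex.
move=> P; rewrite /= => /nbhs_ballP[d /= d0 Hd].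
have [tb'|bt] := ltP t b.
  pose x := t + Num.min d (b - t) / 2.
  have m0 : 0 < Num.min d (b - t) by rewrite lt_min d0 subr_gt0.
  have md : Num.min d (b - t) <= d by rewrite ge_min lexx.
  have mb : Num.min d (b - t) <= b - t by rewrite ge_min lexx orbT.
  exists x; apply: Hd; rewrite /x.
  - by rewrite /ball/= opprD addNKr normrN gtr0_norm//; lra.
  - by apply/eqP; lra.
  - by rewrite /= in_itv/=; apply/andP; split; lra.
pose x := t - Num.min d (t - a) / 2.
have m0 : 0 < Num.min d (t - a) by rewrite lt_min d0 subr_gt0; lra.
have md : Num.min d (t - a) <= d by rewrite ge_min lexx.
have mb : Num.min d (t - a) <= t - a by rewrite ge_min lexx orbT.
exists x; apply: Hd; rewrite /x.
- by rewrite /ball/= opprB addrC subrK gtr0_norm//; lra.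
- by apply/eqP; lra.
- by rewrite /= in_itv/=; apply/andP; split; lra.
Qed.

Lemma derive_withinE a b f t l : a < b -> a <= t -> t <= b ->
  diffq_within a b f t --> l -> derive_within a b f t = l.
Proof.
move=> ab ta tb H; have ? := within_punctured_proper ab ta tb.
exact: cvg_lim H.
Qed.

Lemma derivable_within_is_derive a b f t : a < t -> t < b ->
  derivable_within a b f t -> is_derive t 1 f (derive_within a b f t).
Proof. by move=> ta tb df; apply: diffq_is_derive df. Qed.

Lemma diffq_within_eq a b f g t l : f t = g t ->
  (exists2 d, 0 < d & forall x, a <= x -> x <= b -> x != t -> `|x - t| < d -> f x = g x) ->
  diffq_within a b f t --> l -> diffq_within a b g t --> l.
Proof.
move=> fgt [d d0 fg] /cvg_diffq_withinP H; apply/cvg_diffq_withinP => e /H[d' d'0 Hd].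
exists (Num.min d d'); first by rewrite lt_min d0.
by move=> x ax xb xt; rewrite lt_min => /andP[xd xd']; rewrite -fgt -fg//; exact: Hd.
Qed.

Lemma continuous_withinP a b f : {within `[a, b], continuous f} <->
  forall t, a <= t -> t <= b -> forall e, 0 < e -> exists2 d, 0 < d &
    forall x, a <= x -> x <= b -> `|x - t| < d -> `|f t - f x| < e.
Proof.
split => [/subspace_continuousP H t ta tb e e0|H].
  have tab : `[a, b]%classic t by rewrite /= in_itv/= ta tb.
  have /cvgrPdist_lt/(_ e e0) := H t tab.
  rewrite near_withinE => /nbhs_ballP[d /= d0 Hd]; exists d => // x ax xb xd.
  by apply: Hd; rewrite /ball/= ?in_itv/= ?ax// distrC.
apply/subspace_continuousP => t /=; rewrite in_itv/= => /andP[ta tb].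
apply/cvgrPdist_lt => e /(H t ta tb)[d d0 Hd]; rewrite near_withinE.
apply/nbhs_ballP; exists d => //= x; rewrite /ball/= distrC => xd.
by rewrite in_itv/= => /andP[ax xb]; exact: Hd.
Qed.

Lemma derivable_within_continuous_at a b f t : derivable_within a b f t ->
  forall e, 0 < e -> exists2 d, 0 < d &
    forall x, a <= x -> x <= b -> `|x - t| < d -> `|f t - f x| < e.
Proof.
set l := derive_within a b f t.
move=> /cvg_diffq_withinP/(_ 1 ltr01)[d d0 Hd] e e0; rewrite -/(derive_within a b f t) -/l in Hd.
have l0 : 0 < `|l| + 1 by rewrite ltr_wpDl.
exists (Num.min d (e / (`|l| + 1))); first by rewrite lt_min d0 divr_gt0.
move=> x ax xb; rewrite lt_min ltr_pdivlMr// => /andP[xd xe].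
have [->|xt] := eqVneq x t; first by rewrite subrr normr0.
have xt0 : x - t != 0 by rewrite subr_eq0.
have := Hd x ax xb xt xd; rewrite distrC => Hx.
apply: le_lt_trans xe; rewrite distrC.
rewrite -[f x - f t](divfK xt0) normrM mulrC ler_wpM2l//.
have := ler_normD ((f x - f t) / (x - t) - l) l; rewrite subrK; lra.
Qed.

Lemma derivable_within_continuous_within a b f :
  (forall t, a <= t -> t <= b -> derivable_within a b f t) ->
  {within `[a, b], continuous f}.
Proof.
move=> H; apply/continuous_withinP => t ta tb.
exact/derivable_within_continuous_at/H.
Qed.

Lemma continuous_within_congr a b f g :
  (forall x, a <= x -> x <= b -> f x = g x) ->
  {within `[a, b], continuous f} -> {within `[a, b], continuous g}.
Proof.
move=> fg /continuous_withinP H; apply/continuous_withinP => t ta tb e.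
move=> /(H t ta tb)[d d0 Hd]; exists d => // x ax xb xd.
by rewrite -!fg//; exact: Hd.
Qed.

(** [ok i] marks the points where order i is under control. For Green's functions this means every
    point up to order n-2 and the points off the diagonal afterwards; being locally stable lets the
    induction differentiate once more. *)
Lemma deriven_withinE a b (ok : nat -> R -> Prop) (N : nat) (F : nat -> R -> R) :
  a < b ->
  (forall i t, (i < N)%N -> a <= t -> t <= b -> ok i.+1 t ->
     [/\ ok i t, diffq_within a b (F i) t --> F i.+1 t &
         exists2 d, 0 < d & forall x, a <= x -> x <= b -> `|x - t| < d -> ok i x]) ->
  forall i t, (i <= N)%N -> a <= t -> t <= b -> ok i t ->
    deriven_within a b i (F 0%N) t = F i t.
Proof.
move=> ab H; elim=> [//|i IH] t iN ta tb okt.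
have [okit dF [d d0 Hd]] := H i t iN ta tb okt.
apply: derive_withinE => //; apply: diffq_within_eq dF.
  by apply/esym/IH => //; exact: ltnW.
by exists d => // x ax xb _ xd; apply/esym/IH => //; [exact: ltnW|exact: Hd].
Qed.

Lemma smooth_deriven_within a b (F : nat -> R -> R) :
  a < b -> (forall i t, is_derive t 1 (F i) (F i.+1 t)) ->
  forall i t, a <= t -> t <= b -> deriven_within a b i (F 0%N) t = F i t.
Proof.
move=> ab dF i t ta tb.
apply: (@deriven_withinE a b (fun _ _ => True) i) => // j x _ _ _ _; split => //.
  exact: is_derive_diffq.
by exists 1.
Qed.

Lemma smooth_Cn a b (F : nat -> R -> R) (n : nat) :
  a < b -> (forall i t, is_derive t 1 (F i) (F i.+1 t)) -> is_Cn a b n (F 0%N).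
Proof.
move=> ab dF; have E := smooth_deriven_within ab dF.
have D i t : t \in `[a, b]%R -> derivable_within a b (deriven_within a b i (F 0%N)) t.
  rewrite in_itv/= => /andP[ta tb]; apply/cvg_ex; exists (F i.+1 t).
  apply: diffq_within_eq (is_derive_diffq a b (dF i t)); first by rewrite E.
  by exists 1 => // x ax xb _ _; rewrite E.
split => [i t _|]; first exact: D.
by apply: derivable_within_continuous_within => t ta tb; apply: D; rewrite in_itv/= ta tb.
Qed.

(** Taking [b] as the exceptional point exempts no point of the open interval; this is how smooth
    functions enter as chains. *)
Lemma Cn_chain a b n u : is_Cn a b n u ->
  chain a b b n (fun i => deriven_within a b i u).
Proof.
move=> [du _] i iN; split.
  by apply: derivable_within_continuous_within => t ta tb; apply: du; rewrite // in_itv/= ta tb.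
move=> t ta tb _; apply: derivable_within_is_derive => //.
by apply: du; rewrite // in_itv/= !ltW.
Qed.

End WithinDerivative.

(** * The fundamental solution as a power series *)

Section ExponentialSeries.
Context {R : realType}.
Implicit Types (al be : nat -> R) (t B C M : R) (n j k p : nat).

(** The exponential generating function: differentiation becomes a shift of the coefficients, so all
    derivatives of the fundamental solution belong to one family. *)
Definition egf al t : R := limn (series (fun k => al k / k`!%:R * t ^+ k)).

Definition exp_bounded al C B := forall k, `|al k| <= C * B ^+ k.

Lemma egf_normed_cvg al C B t : 0 <= B -> exp_bounded al C B ->
  cvgn [normed series (fun k => al k / k`!%:R * t ^+ k)] /\
  limn [normed series (fun k => al k / k`!%:R * t ^+ k)] <= C * expR (B * `|t|).
Proof.
move=> B0 ab.
have C0 : 0 <= C by have := ab 0%N; rewrite expr0 mulr1; apply: le_trans.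
set u := fun k => _.
have cv := is_cvg_series_exp_coeff (B * `|t|).
have le k : `|u k| <= (C *: exp_coeff (B * `|t|)) k.
  have -> : (C *: exp_coeff (B * `|t|)) k = C * B ^+ k * (k`!%:R^-1 * `|t| ^+ k).
    by rewrite -[LHS]/(C * ((B * `|t|) ^+ k / k`!%:R)) exprMn; ring.
  rewrite /u !normrM normfV normrX normr_nat -mulrA.
  by rewrite ler_wpM2r// mulr_ge0 ?invr_ge0// exprn_ge0.
have cvC : cvgn (series (C *: exp_coeff (B * `|t|))) by exact: is_cvg_seriesZ.
have cvu : cvgn [normed series u].
  apply: series_le_cvg cvC => // k; first exact: normr_ge0.
  by rewrite (le_trans _ (le k)).
split => //; rewrite -[X in _ <= X]/(C *: limn (series (exp_coeff (B * `|t|)))).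
by rewrite -lim_seriesZ//; exact: lim_series_le.
Qed.

Lemma egf_cvg al C B t : 0 <= B -> exp_bounded al C B ->
  cvgn (series (fun k => al k / k`!%:R * t ^+ k)).
Proof.
by move=> B0 ab; apply: (@normed_cvg R R^o); exact: (egf_normed_cvg t B0 ab).1.
Qed.

Lemma egf_bound al C B t : 0 <= B -> exp_bounded al C B ->
  `|egf al t| <= C * expR (B * `|t|).
Proof.
move=> B0 ab; have [cv le] := egf_normed_cvg t B0 ab.
by apply: le_trans le; exact: (@lim_series_norm R R^o).
Qed.

Lemma exp_bounded_shift al C B j : exp_bounded al C B ->
  exp_bounded (fun k => al (j + k)%N) (C * B ^+ j) B.
Proof. by move=> ab k; rewrite -mulrA -exprD. Qed.

Lemma is_derive_egf al C B t : 0 <= B -> exp_bounded al C B ->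
  is_derive t 1 (egf al) (egf (fun k => al k.+1) t).
Proof.
move=> B0 ab.
have diffsE be : pseries_diffs (fun k => be k / k`!%:R) = (fun k => be k.+1 / k`!%:R).
  apply/funext => k; rewrite /pseries_diffs factS natrM invfM mulrCA.
  by rewrite mulVKf// pnatr_eq0.
have := @pseries_snd_diffs R (fun k => al k / k`!%:R) (`|t| + 1) t.
rewrite !diffsE; apply.
- exact: (egf_cvg B0 ab).
- exact: (egf_cvg B0 (exp_bounded_shift 1 ab)).
- exact: (egf_cvg B0 (exp_bounded_shift 2 ab)).
- by rewrite [X in _ < X]ger0_norm ?ltrDl// addr_ge0.
Qed.

Lemma egfB al be C B C' B' t : 0 <= B -> exp_bounded al C B ->
  0 <= B' -> exp_bounded be C' B' ->
  egf al t - egf be t = egf (fun k => al k - be k) t.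
Proof.
move=> B0 ab B'0 bb; rewrite /egf -lim_seriesB; [|exact: egf_cvg ab|exact: egf_cvg bb].
by congr (limn (series _)); apply/funext => k /=; rewrite -mulrBl -mulrBl.
Qed.

Lemma egfZ al C B c t : 0 <= B -> exp_bounded al C B ->
  egf (fun k => c * al k) t = c * egf al t.
Proof.
move=> B0 ab; rewrite /egf -[RHS]lim_seriesZ; last exact: egf_cvg ab.
by congr (limn (series _)); apply/funext => k; rewrite -[RHS]/(c * (al k / k`!%:R * t ^+ k)) !mulrA.
Qed.

Lemma egf0 al : egf al 0 = al 0%N.
Proof.
apply: cvg_lim => //; rewrite -(cvg_shiftS _)/=.
have -> : (fun n => series (fun k => al k / k`!%:R * 0 ^+ k) n.+1) = cst (al 0%N).
  apply/funext => n; rewrite /series/= big_nat_recl//= expr0 fact0 divr1 mulr1.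
  by rewrite big1 ?addr0// => i _; rewrite expr0n mulr0.
exact: cvg_cst.
Qed.

(* The derivatives at 0 of the solution E of E^(n) + M E = 0 whose only nonzero
   initial datum is E^(n-1)(0) = 1. *)
Definition kernel_coeff M n p : R :=
  if (n %| p.+1)%N then (- M) ^+ (p.+1 %/ n).-1 else 0.

(* [kernel M n j] is the derivative of order [j] of E. *)
Definition kernel M n j : R -> R := egf (fun k => kernel_coeff M n (j + k)).

Lemma kernel_coeff_period M n p : (0 < n)%N ->
  kernel_coeff M n (p + n) = - M * kernel_coeff M n p.
Proof.
move=> n0; rewrite /kernel_coeff -addSn dvdn_addl//; case: ifP => [np|]; last by rewrite mulr0.
by rewrite divnDr// divnn n0 addn1 /= -exprS prednK// divn_gt0// dvdn_leq.
Qed.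

Let kernel_exponent n p : (n %| p.+1)%N -> ((p.+1 %/ n).-1 <= p)%N.
Proof.
move=> np; have n0 := dvdn_gt0 (ltn0Sn p) np.
by rewrite -ltnS prednK ?leq_div// divn_gt0// dvdn_leq.
Qed.

(** With B >= 1 the exponent (p+1)/n - 1 may be rounded up to p. *)
Lemma kernel_coeff_bounded M B n : 1 <= B -> `|M| <= B ->
  exp_bounded (kernel_coeff M n) 1 B.
Proof.
move=> B1 MB p; have B0 : 0 <= B by rewrite (le_trans _ B1).
rewrite mul1r /kernel_coeff; case: ifP => [np|_]; last by rewrite normr0 exprn_ge0.
rewrite normrX normrN (@le_trans _ _ (B ^+ (p.+1 %/ n).-1)) ?lerXn2r ?nnegrE//.
by rewrite ler_weXn2l//; exact: kernel_exponent.
Qed.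

(** The factor r B^(r-1) of the mean value theorem is replaced by the cruder (2B)^r, which has the
    geometric form that [exp_bounded] asks for. *)
Let lipschitz_power (x y B : R) r : 1 <= B -> `|x| <= B -> `|y| <= B ->
  `|x ^+ r - y ^+ r| <= `|x - y| * (2 * B) ^+ r.
Proof.
move=> B1 xB yB; have B0 : 0 <= B by rewrite (le_trans _ B1).
elim: r => [|r IH]; first by rewrite !expr0 subrr normr0 mulr1.
have -> : x ^+ r.+1 - y ^+ r.+1 = x * (x ^+ r - y ^+ r) + (x - y) * y ^+ r.
  by rewrite !exprS; ring.
rewrite (le_trans (ler_normD _ _))// !normrM.
have h1 : `|x| * `|x ^+ r - y ^+ r| <= B * (`|x - y| * (2 * B) ^+ r).
  exact: ler_pM.
have h2 : `|x - y| * `|y ^+ r| <= `|x - y| * (B * (2 * B) ^+ r).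
  rewrite ler_wpM2l// normrX (@le_trans _ _ ((2 * B) ^+ r))//.
    by rewrite lerXn2r ?nnegrE//; [exact: mulr_ge0|lra].
  by rewrite ler_peMl// exprn_ge0// mulr_ge0.
by rewrite exprS (le_trans (lerD h1 h2))// le_eqVlt; apply/orP; left; apply/eqP; ring.
Qed.

Lemma kernel_coeff_lipschitz M M' B n : 1 <= B -> `|M| <= B -> `|M'| <= B ->
  exp_bounded (fun p => kernel_coeff M n p - kernel_coeff M' n p) `|M - M'| (2 * B).
Proof.
move=> B1 MB M'B p; have B0 : 0 <= B by rewrite (le_trans _ B1).
rewrite /kernel_coeff; case: ifP => [np|_]; last first.
  by rewrite subr0 normr0 mulr_ge0// exprn_ge0// mulr_ge0.
rewrite (le_trans (lipschitz_power _ B1 _ _)) ?normrN//.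
rewrite opprK addrC distrC ler_wpM2l// ler_weXn2l//; first by lra.
exact: kernel_exponent.
Qed.

Let big M : R := Num.max 1 `|M|.

Let big1 M : 1 <= big M. Proof. by rewrite le_max lexx. Qed.

Let big0 M : 0 <= big M. Proof. by rewrite (le_trans _ (big1 M)). Qed.

Let bigM M : `|M| <= big M. Proof. by rewrite le_max lexx orbT. Qed.

Let bounded M n := kernel_coeff_bounded n (big1 M) (bigM M).

Lemma is_derive_kernel M n j t : is_derive t 1 (kernel M n j) (kernel M n j.+1 t).
Proof.
have := is_derive_egf t (big0 M) (exp_bounded_shift j (bounded M n)).
suff -> : kernel M n j.+1 = egf (fun k => kernel_coeff M n (j + k.+1)) by [].
by congr egf; apply/funext => k; rewrite addSnnS.
Qed.

Lemma kernel_period M n j t : (0 < n)%N -> kernel M n (j + n) t = - M * kernel M n j t.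
Proof.
move=> n0; rewrite /kernel -(egfZ _ _ (big0 M) (exp_bounded_shift j (bounded M n))).
by congr (egf _ _); apply/funext => k; rewrite -kernel_coeff_period// addnAC.
Qed.

Lemma kernel0 M n j : kernel M n j 0 = kernel_coeff M n j.
Proof. by rewrite /kernel egf0 addn0. Qed.

Lemma continuous_kernel M n j : continuous (kernel M n j).
Proof.
move=> t; apply: differentiable_continuous; apply/derivable1_diffP.
by have [] := is_derive_kernel M n j t.
Qed.

Lemma kernel_lipschitz B T n j : 1 <= B -> exists2 C : R, 0 <= C &
  forall M M' t, `|M| <= B -> `|M'| <= B -> `|t| <= T ->
    `|kernel M n j t - kernel M' n j t| <= `|M - M'| * C.
Proof.
move=> B1; have B0 : 0 <= B by rewrite (le_trans _ B1).
have B2 : 0 <= 2 * B by exact: mulr_ge0.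
exists ((2 * B) ^+ j * expR (2 * B * T)); first by rewrite mulr_ge0 ?exprn_ge0// expR_ge0.
move=> M M' t MB M'B tT; rewrite /kernel.
rewrite (egfB _ (big0 M) (exp_bounded_shift j (bounded M n)) (big0 M')
  (exp_bounded_shift j (bounded M' n))).
have := egf_bound t B2 (exp_bounded_shift j (kernel_coeff_lipschitz n B1 MB M'B)).
move=> /le_trans; apply; rewrite -mulrA ler_wpM2l// ler_wpM2l ?exprn_ge0//.
by rewrite ler_expR ler_wpM2l.
Qed.

End ExponentialSeries.

(** * The linear system of boundary conditions *)

Section BoundarySystem.
Context {R : realType}.

Lemma cvg_det (T : Type) (F : set_system T) (n : nat) (A : T -> 'M[R]_n) (B : 'M[R]_n) :
  Filter F -> (forall i j, A x i j @[x --> F] --> B i j) ->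
  \det (A x) @[x --> F] --> \det B.
Proof.
move=> FF AB; apply: cvg_big => [|s _]; first exact: add_continuous.
apply: cvgM; first exact: cvg_cst.
by apply: cvg_big => [|i _]; [exact: mul_continuous|exact: AB].
Qed.

Lemma cvg_adj (T : Type) (F : set_system T) (n : nat) (A : T -> 'M[R]_n) (B : 'M[R]_n) i j :
  Filter F -> (forall i j, A x i j @[x --> F] --> B i j) ->
  (\adj (A x)) i j @[x --> F] --> (\adj B) i j.
Proof.
move=> FF AB; rewrite mxE; under eq_cvg do rewrite mxE.
apply: cvgM; first exact: cvg_cst.
apply: (@cvg_det _ _ _ (fun x => row' j (col' i (A x)))) => i' j'.
by rewrite !mxE; under eq_cvg do rewrite !mxE; exact: AB.
Qed.

(** Numbering the n conditions, each tagged with its endpoint, makes the system for the n initial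
    data square, so that determinant and adjugate are at hand. *)
Lemma enumerate_conditions (n : nat) (SA SB : {set 'I_n}) : (#|SA| + #|SB| = n)%N ->
  exists c : 'I_n -> bool * 'I_n, forall side i,
    (i \in if side then SA else SB) <-> exists r, c r = (side, i).
Proof.
move=> card; pose P := [set p : bool * 'I_n | p.2 \in if p.1 then SA else SB]%SET.
have cardP : #|P| = n.
  have -> : #|P| = (\sum_p ((p.1, p.2) \in P : nat))%N.
    by rewrite -sum1_card big_mkcond; apply: eq_bigr => -[side i] _; case: ifP.
  rewrite -(pair_bigA _ (fun side i => ((side, i) \in P : nat)))/= big_bool/=.
  rewrite -[RHS]card -!sum1_card.
  by congr addn; rewrite [RHS]big_mkcond; apply: eq_bigr => i _; rewrite inE/=; case: ifP.
exists (fun r => enum_val (cast_ord (esym cardP) r)) => side i; split => [iS|[r rE]].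
  have iP : (side, i) \in P by rewrite inE.
  by exists (cast_ord cardP (enum_rank_in iP (side, i))); rewrite cast_ordK enum_rankK_in.
by have := enum_valP (cast_ord (esym cardP) r); rewrite rE inE.
Qed.

Variables (a b : R) (n : nat).
Hypotheses (ab : a < b) (n_gt0 : (0 < n)%N).
Implicit Types (M s t : R) (x : 'rV[R]_n) (i j : nat).

(* Derivative of order [i] of the solution with initial data [x] at [b]. *)
Definition solution M x i t : R :=
  \sum_(l < n) x 0 l * kernel M n (n.-1 - l + i) (t - b).

Lemma is_derive_shift (f : R -> R) (s t d : R) :
  is_derive (t - s) 1 f d -> is_derive t 1 (fun u => f (u - s)) d.
Proof.
move=> /is_deriveP H; apply/is_deriveP => e /H[r r0 Hr]; exists r => // u ut ur.
have := Hr (u - s); have -> : u - s - (t - s) = u - t by ring.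
by apply => //; rewrite (inj_eq (addIr _)).
Qed.

Lemma is_derive_solution M x i t :
  is_derive t 1 (solution M x i) (solution M x i.+1 t).
Proof.
have := is_derive_sum (h := fun l : 'I_n => x 0 l *: (fun u : R => kernel M n (n.-1 - l + i) (u - b)))
  (dh := fun l : 'I_n => x 0 l *: kernel M n (n.-1 - l + i.+1) (t - b)) (x := t) (v := 1).
move=> /(_ _)/wrap[|H].
  move=> l; apply: is_deriveZ; apply: is_derive_shift; rewrite addnS.
  exact: is_derive_kernel.
apply: is_derive_ext H => // u; rewrite /solution.
by elim/big_ind2 : _ => // f g f' g' <- <-.
Qed.

Lemma continuous_solution M x i : continuous (solution M x i).
Proof.
move=> t; apply: differentiable_continuous; apply/derivable1_diffP.
by have [] := is_derive_solution M x i t.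
Qed.

Lemma solution_period M x i t : solution M x (i + n) t = - M * solution M x i t.
Proof.
rewrite /solution mulr_sumr; apply: eq_bigr => l _.
by rewrite addnA kernel_period// mulrCA.
Qed.

Lemma solution_right M x (i : 'I_n) : solution M x i b = x 0 i.
Proof.
rewrite /solution (bigD1 i)//= big1 ?addr0 => [|l li]; rewrite subrr kernel0 /kernel_coeff.
  have -> : ((n.-1 - i + i).+1 = n)%N by rewrite subnK ?prednK// -ltnS prednK.
  by rewrite dvdnn divnn n_gt0 expr0 mulr1.
have El : ((n.-1 - l + i).+1 = n - l + i)%N.
  by rewrite -addSn -subSn ?prednK// -ltnS prednK.
rewrite El; case: ifP => [/dvdnP[k E]|_]; last by rewrite mulr0.
have [ln i_n] := (ltn_ord l, ltn_ord i).
(* n - l + i lies between 1 and 2n - 1, so the only multiple of n it can be is n, which forces i =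
   l. *)
have k1 : k = 1%N by nia.
by move: li; rewrite -val_eqE/= => /eqP[]; lia.
Qed.

Variables (SA SB : {set 'I_n}) (c : 'I_n -> bool * 'I_n).
Hypothesis cP : forall side (i : 'I_n),
  (i \in if side then SA else SB) <-> exists r, c r = (side, i).

Definition boundary_matrix M : 'M[R]_n := \matrix_(l, r)
  kernel M n (n.-1 - l + (c r).2) ((if (c r).1 then a else b) - b).

Lemma boundary_matrixE M x r : (x *m boundary_matrix M) 0 r =
  solution M x (c r).2 (if (c r).1 then a else b).
Proof. by rewrite mxE /solution; apply: eq_bigr => l _; rewrite mxE. Qed.

Lemma solution_eq0 M x : (forall t, a <= t -> t <= b -> solution M x 0 t = 0) -> x = 0.
Proof.
move=> x0.
have cont i : {within `[a, b], continuous (solution M x i)}.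
  exact/continuous_subspaceT/continuous_solution.
have all0 i : forall t, a < t -> t < b -> solution M x i t = 0.
  elim: i => [t ta tb|i IH t ta tb]; first by rewrite x0 ?ltW.
  exact: derive_zero_on IH ta tb (is_derive_solution M x i t).
apply/rowP => i; rewrite mxE -(solution_right M).
by apply: (zero_closure ab (cont i) (all0 i)) => //; exact: ltW.
Qed.

(** A row vector killed by the matrix consists of the data at b of a solution meeting every
    condition, that is, of an eigenfunction. *)
Lemma det_boundary_matrix M : ~ is_eigenvalue a b SA SB M -> \det (boundary_matrix M) != 0.
Proof.
move=> Neig; apply/negP => /det0P[x xN0 x0]; apply: Neig.
have dsol := is_derive_solution M x; have E := smooth_deriven_within ab dsol.
exists (solution M x 0); split.
- split; first exact: smooth_Cn ab dsol.
  split => i iS; rewrite E ?lexx ?ltW//.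
    have [r rE] := (cP true i).1 iS.
    by have := boundary_matrixE M x r; rewrite rE x0 mxE.
  have [r rE] := (cP false i).1 iS.
  by have := boundary_matrixE M x r; rewrite rE x0 mxE.
- apply: contrapT => H; move/eqP: xN0; apply; apply: (@solution_eq0 M) => t ta tb.
  by apply: contrapT => /eqP t0; apply: H; exists t; rewrite // in_itv/= ta tb.
- move=> t; rewrite in_itv/= => /andP[ta tb].
  by rewrite E// -[in X in X + _](add0n n) solution_period mulNr addNr.
Qed.

(** The Green's function will be a solution minus E(t - s) cut off to t < s. The cut-off part is
    invisible at b, so only the conditions at a are inhomogeneous. *)
Definition green_rhs M s : 'rV[R]_n :=
  \row_r if (c r).1 then kernel M n (c r).2 (a - s) else 0.

(** Cramer's formula, chosen because it shows continuity in both [M] and [s]. *)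
Definition green_coef M s : 'rV[R]_n :=
  (\det (boundary_matrix M))^-1 *: (green_rhs M s *m \adj (boundary_matrix M)).

Lemma green_coefP M s : \det (boundary_matrix M) != 0 ->
  green_coef M s *m boundary_matrix M = green_rhs M s.
Proof.
move=> d0; rewrite /green_coef -scalemxAl -mulmxA mul_adj_mx mul_mx_scalar scalerA.
by rewrite mulVf// scale1r.
Qed.

(** The arbitrary filter serves twice: [s] varies with [M] fixed for joint continuity, and [M]
    varies with [s] = b for dependence on the parameter. *)
Lemma cvg_green_coef (T : Type) (F : set_system T) (M : T -> R) (s : T -> R) M0 s0 l :
  Filter F -> \det (boundary_matrix M0) != 0 ->
  (forall j t, kernel (M x) n j t @[x --> F] --> kernel M0 n j t) ->
  (forall j, kernel (M x) n j (a - s x) @[x --> F] --> kernel M0 n j (a - s0)) ->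
  green_coef (M x) (s x) 0 l @[x --> F] --> green_coef M0 s0 0 l.
Proof.
move=> FF d0 kM ks.
have cA (i j : 'I_n) : boundary_matrix (M x) i j @[x --> F] --> boundary_matrix M0 i j.
  by rewrite !mxE; under eq_cvg do rewrite !mxE; exact: kM.
rewrite /green_coef !mxE; under eq_cvg do rewrite !mxE.
apply: cvgM; first by apply: cvgV => //; exact: cvg_det.
apply: cvg_big => [|r _]; first exact: add_continuous.
apply: cvgM; last exact: cvg_adj.
rewrite !mxE; under eq_cvg do rewrite !mxE.
by case: (c r).1; [exact: ks|exact: cvg_cst].
Qed.

Lemma green_solution_left M s (i : 'I_n) : \det (boundary_matrix M) != 0 -> i \in SA ->
  solution M (green_coef M s) i a = kernel M n i (a - s).
Proof.
move=> d0 /(cP true i).1[r rE]; have := boundary_matrixE M (green_coef M s) r.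
by rewrite green_coefP// mxE rE.
Qed.

Lemma green_solution_right M s (i : 'I_n) : \det (boundary_matrix M) != 0 -> i \in SB ->
  solution M (green_coef M s) i b = 0.
Proof.
move=> d0 /(cP false i).1[r rE]; have := boundary_matrixE M (green_coef M s) r.
by rewrite green_coefP// mxE rE.
Qed.

End BoundarySystem.

(** * Construction of the Green's function *)

Section GreenFunction.
Context {R : realType}.
Variables (a b : R) (n : nat).
Hypotheses (ab : a < b) (n_ge2 : (2 <= n)%N).
Variables (SA SB : {set 'I_n}) (c : 'I_n -> bool * 'I_n).
Hypothesis cP : forall side (i : 'I_n),
  (i \in if side then SA else SB) <-> exists r, c r = (side, i).
Implicit Types (M s t : R) (i j : nat).

Let n_gt0 : (0 < n)%N. Proof. exact: ltnW. Qed.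

(** Cutting E off on the side t < 0 leaves the Green's function a genuine solution between s and b;
    the jump is E^(n-1)(0) = 1. *)
Definition half_kernel M i t : R := if t < 0 then kernel M n i t else 0.

Definition green_deriv M i t s : R :=
  solution b M (green_coef a b c M s) i t - half_kernel M i (t - s).

Let kernel_coeff_lt M i : (i.+1 < n)%N -> kernel_coeff M n i = 0.
Proof. by move=> i_n; rewrite /kernel_coeff gtnNdvd. Qed.

(** The derivatives of E of order below n-1 vanish at 0, so the two pieces fit together there. *)
Lemma continuous_half_kernel M i : (i.+1 < n)%N -> continuous (half_kernel M i).
Proof.
move=> i_n t; apply/cvgrPdist_lt => e e0.
have k0 : kernel M n i 0 = 0 by rewrite kernel0 kernel_coeff_lt.
have /cvgrPdist_lt/(_ e e0) := @continuous_kernel R M n i t.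
have /cvgrPdist_lt/(_ e e0) := @continuous_kernel R M n i 0.
have [t0|t0|->] := ltgtP t 0.
- move=> _; have tI : t \in `]t - 1, 0[%R by rewrite in_itv/= t0 ltrBlDr ltrDl ltr01.
  apply: filterS2 (near_in_itvoo tI) => x; rewrite in_itv/= => /andP[_ x0].
  by rewrite /half_kernel t0 x0.
- move=> _ _; have tI : t \in `]0, t + 1[%R by rewrite in_itv/= t0 ltrDl ltr01.
  apply: filterS (near_in_itvoo tI) => x; rewrite in_itv/= => /andP[x0 _].
  by rewrite /half_kernel (lt_gtF t0) (lt_gtF x0) subrr normr0.
- move=> + _; apply: filterS => x; rewrite k0 /half_kernel ltxx.
  by case: ifP => // _; rewrite subrr normr0.
Qed.

Lemma is_derive_half_kernel M i t : (i.+2 < n)%N || (t != 0) ->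
  is_derive t 1 (half_kernel M i) (half_kernel M i.+1 t).
Proof.
have [t0 _|t0 _|->] := ltgtP t 0.
- have tI : t \in `]t - 1, 0[%R by rewrite in_itv/= t0 ltrBlDr ltrDl ltr01.
  rewrite /half_kernel t0; apply: near_eq_is_derive (is_derive_kernel M n i t).
  by apply: filterS (near_in_itvoo tI) => x; rewrite in_itv/= => /andP[_ ->].
- have tI : t \in `]0, t + 1[%R by rewrite in_itv/= t0 ltrDl ltr01.
  rewrite /half_kernel ltNge (ltW t0)/=.
  have dc : is_derive t 1 (cst 0 : R -> R) (0 : R) by exact: is_derive_cst.
  apply: near_eq_is_derive dc; apply: filterS (near_in_itvoo tI) => x.
  by rewrite in_itv/= => /andP[x0 _]; rewrite ltNge (ltW x0).
rewrite orbF => i_n; apply/is_deriveP => e e0.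
have /is_deriveP/(_ e e0)[d d0 Hd] := is_derive_kernel M n i 0.
exists d => // x x0 xd; have := Hd x x0 xd.
rewrite /half_kernel ltxx !kernel0 !kernel_coeff_lt//; last exact: ltnW.
by case: ifP => // _; rewrite !subr0 mul0r subrr normr0.
Qed.

Lemma is_derive_green M i t s : (i.+2 < n)%N || (t != s) ->
  is_derive t 1 (green_deriv M i ^~ s) (green_deriv M i.+1 t s).
Proof.
move=> it; apply: is_deriveB; first exact: is_derive_solution.
by apply: is_derive_shift; apply: is_derive_half_kernel; rewrite subr_eq0.
Qed.

Lemma continuous_green_coef M l : \det (boundary_matrix a b c M) != 0 ->
  continuous (fun s => green_coef a b c M s 0 l).
Proof.
move=> d0 s; apply: cvg_green_coef => //; first by move=> *; exact: cvg_cst.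
move=> j; apply: (@cvg_comp _ _ _ (fun u => a - u)); last exact: continuous_kernel.
by apply: cvgB; [exact: cvg_cst|exact: cvg_id].
Qed.

Lemma continuous_green_solution M i : \det (boundary_matrix a b c M) != 0 ->
  continuous (fun p : R * R => solution b M (green_coef a b c M p.2) i p.1).
Proof.
move=> d0 p; apply: cvg_big => [|l _]; first exact: add_continuous.
apply: cvgM.
  apply: (@cvg_comp _ _ _ snd (fun s => green_coef a b c M s 0 l)); first exact: cvg_snd.
  exact: continuous_green_coef.
apply: (@cvg_comp _ _ _ (fun p : R * R => p.1 - b)); last exact: continuous_kernel.
by apply: cvgB; [exact: cvg_fst|exact: cvg_cst].
Qed.

Lemma continuous_comp_sub (f : R -> R) : continuous f ->
  continuous (fun p : R * R => f (p.1 - p.2)).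
Proof.
move=> cf p; apply: (@cvg_comp _ _ _ (fun p : R * R => p.1 - p.2)); last exact: cf.
by apply: cvgB; [exact: cvg_fst|exact: cvg_snd].
Qed.

Lemma within_eq_continuous (T U : topologicalType) (D : set T) (f g : T -> U) :
  (forall x, D x -> f x = g x) -> continuous g -> {within D, continuous f}.
Proof.
move=> fg cg; apply: (@subspace_eq_continuous _ D _ g).
  by move=> x /set_mem Dx; apply/esym; exact: fg.
exact: continuous_subspaceT.
Qed.

Lemma dt_green M i t s : a <= t -> t <= b -> (i.+1 < n)%N || (t != s) ->
  dt a b i (green_deriv M 0) t s = green_deriv M i t s.
Proof.
move=> ta tb ok.
apply: (@deriven_withinE R a b (fun i t => (i.+1 < n)%N || (t != s)) i
  (fun i t => green_deriv M i t s)) => // j x _ xa xb okx; split.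
- by case/orP: okx => [/ltnW ->//|->]; rewrite orbT.
- exact/is_derive_diffq/is_derive_green.
- case/orP: okx => [/ltnW ->|xs]; first by exists 1.
  exists `|x - s|; first by rewrite normr_gt0 subr_eq0.
  move=> u _ _; have [->|us _] := eqVneq u s; last by rewrite orbT.
  by rewrite distrC ltxx.
Qed.

Lemma derivable_dt_green M i t s : a <= t -> t <= b -> (i.+2 < n)%N || (t != s) ->
  derivable_within a b (fun x => dt a b i (green_deriv M 0) x s) t.
Proof.
move=> ta tb ok; apply/cvg_ex; exists (green_deriv M i.+1 t s).
have ok' : (i.+1 < n)%N || (t != s) by case/orP: ok => [/ltnW ->|->]; rewrite ?orbT.
apply: diffq_within_eq (is_derive_diffq a b (is_derive_green M ok)).
  by rewrite dt_green.
case/orP: ok => [/ltnW i_n|ts]; first by exists 1 => // x ax xb _ _; rewrite dt_green ?i_n.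
exists `|t - s|; first by rewrite normr_gt0 subr_eq0.
move=> x ax xb _ xd; rewrite dt_green//.
by have [xs|xs] := eqVneq x s; [move: xd; rewrite xs distrC ltxx|rewrite orbT].
Qed.

Lemma green_period M t s : green_deriv M n t s = - M * green_deriv M 0 t s.
Proof.
have := solution_period b n_gt0 M (green_coef a b c M s) 0 t; rewrite add0n => solE.
have := kernel_period M 0 (t - s) n_gt0; rewrite add0n => kerE.
rewrite /green_deriv /half_kernel solE kerE mulrBr.
by case: ifP => // _; rewrite mulr0.
Qed.

(** For s = a the kernel is already cut off at a; below order n-1 this is harmless because the
    kernel vanishes there. *)
Lemma green_left M s (i : 'I_n) : \det (boundary_matrix a b c M) != 0 ->
  i \in SA -> a <= s -> (i.+1 < n)%N || (a < s) -> green_deriv M i a s = 0.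
Proof.
move=> d0 iA; rewrite /green_deriv (green_solution_left cP)// /half_kernel subr_lt0.
rewrite le_eqVlt => /predU1P[->|as_]; last by rewrite as_ subrr.
by rewrite ltxx orbF subrr kernel0 => i_n; rewrite kernel_coeff_lt// subr0.
Qed.

Lemma green_right M s (i : 'I_n) : \det (boundary_matrix a b c M) != 0 ->
  i \in SB -> s <= b -> green_deriv M i b s = 0.
Proof.
move=> d0 iB sb; rewrite /green_deriv (green_solution_right cP)// /half_kernel.
by rewrite subr_lt0 ltNge sb subrr.
Qed.

Lemma is_green_green M : \det (boundary_matrix a b c M) != 0 ->
  is_green a b M SA SB (green_deriv M 0).
Proof.
move=> d0.
have csol i : continuous (fun p : R * R => solution b M (green_coef a b c M p.2) i p.1).
  exact: continuous_green_solution.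
have cker i : continuous (fun p : R * R => kernel M n i (p.1 - p.2)).
  exact/continuous_comp_sub/continuous_kernel.
split; [|split; [|split; [|split; [|split; [|split]]]]].
- move=> i t s i_n; rewrite in_itv/= => /andP[ta tb] _.
  by apply: derivable_dt_green; rewrite ?i_n.
- move=> i i_n; apply: (within_eq_continuous (g := fun p => green_deriv M i p.1 p.2)).
    move=> [t s] [/=]; rewrite in_itv/= => /andP[ta tb] _.
    by rewrite dt_green ?i_n.
  move=> p; apply: cvgB; first exact: csol.
  exact/continuous_comp_sub/continuous_half_kernel.
- move=> i t s _; rewrite in_itv/= => /andP[ta tb] _ ts.
  by apply: derivable_dt_green => //; rewrite ts orbT.
(* On each open triangle the cut-off kernel agrees with a formula continuous on the whole plane. *)
- move=> i _; split.
    apply: (within_eq_continuous (g := fun p => solution b M (green_coef a b c M p.2) i p.1)).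
      move=> [t s] [/= as_ [st tb]]; rewrite dt_green ?gt_eqF ?orbT//.
        by rewrite /green_deriv /half_kernel subr_lt0 ltNge ltW// subr0.
      exact: le_trans as_ (ltW st).
    exact: csol.
  apply: (within_eq_continuous (g := fun p =>
    solution b M (green_coef a b c M p.2) i p.1 - kernel M n i (p.1 - p.2))).
    move=> [t s] [/= at_ [ts sb]]; rewrite dt_green ?lt_eqF ?orbT//.
      by rewrite /green_deriv /half_kernel subr_lt0 ts.
    exact: le_trans (ltW ts) sb.
  by move=> p; apply: cvgB; [exact: csol|exact: cker].
- move=> s; rewrite in_itv/= => /andP[as_ sb].
  pose r t := solution b M (green_coef a b c M s) n.-1 t.
  have cr : continuous r by exact: continuous_solution.
  exists (r s), (r s - 1); split; last by ring.
  + have cr' : r t @[t --> s^'+] --> r s by apply: cvg_at_right_filter; exact: cr.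
    apply: cvg_trans cr'; apply: near_eq_cvg; near=> t.
    have st : s < t by near: t; exact: nbhs_right_gt.
    have tb : t < b by near: t; exact: nbhs_right_lt.
    rewrite dt_green ?gt_eqF ?orbT ?ltW ?(lt_trans as_ st)//.
    by rewrite /green_deriv /half_kernel subr_lt0 ltNge (ltW st) subr0.
  + have cl : r t - kernel M n n.-1 (t - s) @[t --> s^'-] --> r s - 1.
      apply: cvg_at_left_filter; apply: cvgB; first exact: cr.
      have -> : 1 = kernel M n n.-1 (s - s).
        by rewrite subrr kernel0 /kernel_coeff prednK// dvdnn divnn n_gt0.
      apply: (@cvg_comp _ _ _ (fun t => t - s)); last exact: continuous_kernel.
      by apply: cvgB; [exact: cvg_id|exact: cvg_cst].
    apply: cvg_trans cl; apply: near_eq_cvg; near=> t.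
    have st : t < s by near: t; exact: nbhs_left_lt.
    have at_ : a < t by near: t; exact: nbhs_left_gt.
    rewrite dt_green ?lt_eqF ?orbT ?ltW ?(lt_trans st sb)//.
    by rewrite /green_deriv /half_kernel subr_lt0 st.
- move=> t s; rewrite !in_itv/= => /andP[ta tb] _ ts.
  by rewrite dt_green ?ts ?orbT// green_period mulNr addNr.
- move=> s; rewrite in_itv/= => /andP[as_ sb]; split => i iS.
    rewrite -[LHS]/(dt a b i (green_deriv M 0) a s).
    by rewrite dt_green ?lexx ?ltW ?lt_eqF ?orbT// green_left ?ltW ?as_ ?orbT.
  rewrite -[LHS]/(dt a b i (green_deriv M 0) b s).
  by rewrite dt_green ?lexx ?ltW ?gt_eqF ?orbT// green_right ?ltW.
Unshelve. all: by end_near. Qed.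

End GreenFunction.

(** * Consequences of the sign of a given Green's function *)

Section GivenGreenFunction.
Context {R : realType}.

Lemma within_comp (T U V : topologicalType) (D : set U) (S : set T) (F : U -> V) (phi : T -> U) :
  {within D, continuous F} -> continuous phi -> (forall x, S x -> D (phi x)) ->
  {within S, continuous (F \o phi)}.
Proof.
move=> /subspace_continuousP cF cphi SD; apply/subspace_continuousP => x Sx P FP.
have := cF (phi x) (SD x Sx) P FP; rewrite /fmap/= !nbhs_simpl/= /within/= => H.
have := cphi x _ H; rewrite /fmap/= nbhs_simpl/=; apply: filterS => y Dy Sy.
by apply: Dy; exact: SD.
Qed.

Lemma continuous_pairl (s : R) : continuous (fun t : R => (t, s)).
Proof.
move=> t; apply: (@cvg_pair _ _ _ (nbhs t) (nbhs t) (nbhs s) _ _ _ id (cst s)).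
  exact: cvg_id.
exact: cvg_cst.
Qed.

Lemma continuous_pairr (t : R) : continuous (fun s : R => (t, s)).
Proof.
move=> s; apply: (@cvg_pair _ _ _ (nbhs s) (nbhs t) (nbhs s) _ _ _ (cst t) id).
  exact: cvg_cst.
exact: cvg_id.
Qed.

Lemma within_affine (x y c d : R) (f : R -> R) : {within `[x, y], continuous f} ->
  {within `[x, y], continuous (fun t => c + d * f t)}.
Proof.
move=> /subspace_continuousP cf; apply/subspace_continuousP => t txy.
apply: cvgD; first exact: cvg_cst.
by apply: cvgM; [exact: cvg_cst|exact: cf].
Qed.

Lemma mean_value_bound (x y C : R) (f f' : R -> R) : x < y ->
  {within `[x, y], continuous f} ->
  (forall t, x < t -> t < y -> is_derive t 1 f (f' t)) ->
  (forall t, x < t -> t < y -> `|f' t| <= C) -> `|f y - f x| <= C * (y - x).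
Proof.
move=> xy cf df fC.
have [z] : exists2 z, z \in `]x, y[%R & f y - f x = f' z * (y - x).
  by apply: MVT => // t; rewrite in_itv/= => /andP[xt ty]; exact: df.
rewrite in_itv/= => /andP[xz zy] ->.
rewrite normrM (gtr0_norm (_ : 0 < y - x)) ?subr_gt0//.
by rewrite ler_wpM2r ?subr_ge0 ?(ltW xy)//; exact: fC.
Qed.

Variables (a b : R) (n q : nat) (A B : nat -> bool) (SA SB : {set 'I_n}).
Hypotheses (ab : a < b) (n_ge2 : (2 <= n)%N) (q_gt0 : (0 < q)%N) (q_lt : (q < n)%N).
Hypothesis A_lt : forall i, A i -> (i < q)%N.
Hypothesis B_ge : forall i, (q <= i < n)%N -> B i.
Hypothesis tails :
  forall i, (i <= q)%N -> (\sum_(i <= j < q) (A j + B j) <= q - i)%N.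
Hypothesis total : (\sum_(0 <= j < q) (A j + B j))%N = q.
Hypothesis A_ord : forall o : 'I_n, A o = (o \in SA).
Hypothesis B_ord : forall o : 'I_n, B o = (o \in SB).
Implicit Types (s t x M m mu : R) (i j : nat) (u : R -> R).

Let nu : R := (-1) ^+ (n - q).
Let w : R := (-1) ^+ (\sum_(0 <= j < q) ~~ A j + (n - q))%N.

Lemma boundary_conditions_nat u : boundary_conditions a b SA SB u ->
  conditions a b A B n (fun i => deriven_within a b i u).
Proof.
move=> [ua ub]; split => i i_n Ci.
  by have := ua (Ordinal i_n); rewrite -A_ord; exact.
by have := ub (Ordinal i_n); rewrite -B_ord; exact.
Qed.

Variables (M : R) (g : R -> R -> R).
Hypothesis gG : is_green a b M SA SB g.

Let h i t s := dt a b i g t s.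

Let n1 : (n.-1.+1 = n)%N. Proof. by rewrite prednK// ltnW. Qed.

Let n1_lt : (n.-1 < n)%N. Proof. by rewrite n1. Qed.

Let top1 : (n.-1 <= n.-1 <= n)%N. Proof. by rewrite leqnn leq_pred. Qed.

Let top2 : (n.-1 <= n <= n)%N. Proof. by rewrite leqnn leq_pred. Qed.

Let lt_pred i : (i < n.-1)%N -> (i.+1 < n)%N. Proof. by rewrite -ltnS n1. Qed.

Let B_top : B n.-1.
Proof. by apply: B_ge; rewrite n1_lt andbT -ltnS n1. Qed.

Lemma green_derivable i t s : (i < n)%N -> a <= t -> t <= b -> a <= s -> s <= b ->
  t != s -> derivable_within a b (h i ^~ s) t.
Proof.
have [G1 [_ [G3 _]]] := gG; move=> i_n ta tb as_ sb ts.
have [i2|i2] := ltnP i.+2 n; first by apply: G1; rewrite // in_itv/= ?ta ?as_.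
by apply: G3; rewrite ?in_itv/= ?ta ?as_//; lia.
Qed.

Lemma green_is_derive i t s : (i < n)%N -> a < t -> t < b -> a <= s -> s <= b ->
  t != s -> is_derive t 1 (h i ^~ s) (h i.+1 t s).
Proof.
move=> i_n ta tb as_ sb ts; apply: derivable_within_is_derive => //.
by apply: green_derivable => //; exact: ltW.
Qed.

Lemma green_is_derive_top t s : a < t -> t < b -> a <= s -> s <= b ->
  t != s -> is_derive t 1 (h n.-1 ^~ s) (h n t s).
Proof.
move=> ta tb as_ sb ts.
by have := green_is_derive n1_lt ta tb as_ sb ts; rewrite n1.
Qed.

Lemma green_continuous_fst i s : (i.+1 < n)%N -> a <= s -> s <= b ->
  {within `[a, b], continuous (h i ^~ s)}.
Proof.
have [_ [G2 _]] := gG; move=> i_n as_ sb.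
apply: (within_comp (G2 i i_n) (@continuous_pairl s)) => x.
by rewrite /= !in_itv/= as_ sb.
Qed.

Lemma green_continuous_snd i t : (i.+1 < n)%N -> a <= t -> t <= b ->
  {within `[a, b], continuous (h i t)}.
Proof.
have [_ [G2 _]] := gG; move=> i_n ta tb.
apply: (within_comp (G2 i i_n) (@continuous_pairr t)) => x.
by rewrite /= !in_itv/= ta tb.
Qed.

Lemma green_continuous_above i s x : (n.-1 <= i <= n)%N -> a <= s -> s < x ->
  {within `[x, b], continuous (h i ^~ s)}.
Proof.
have [_ [_ [_ [G4 _]]]] := gG; move=> i_n as_ sx.
apply: (within_comp (G4 i i_n).1 (@continuous_pairl s)) => t.
by rewrite /= in_itv/= => /andP[xt tb]; split=> //; split=> //; exact: lt_le_trans xt.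
Qed.

Lemma green_continuous_below i s x : (n.-1 <= i <= n)%N -> x < s -> s <= b ->
  {within `[a, x], continuous (h i ^~ s)}.
Proof.
have [_ [_ [_ [G4 _]]]] := gG; move=> i_n xs sb.
apply: (within_comp (G4 i i_n).2 (@continuous_pairl s)) => t.
by rewrite /= in_itv/= => /andP[at_ tx]; split=> //; split=> //; exact: le_lt_trans xs.
Qed.

Lemma green_continuous_below_snd i t x : (n.-1 <= i <= n)%N -> a <= t -> t < x ->
  {within `[x, b], continuous (h i t)}.
Proof.
have [_ [_ [_ [G4 _]]]] := gG; move=> i_n at_ tx.
apply: (within_comp (G4 i i_n).2 (@continuous_pairr t)) => s.
by rewrite /= in_itv/= => /andP[xs sb]; split=> //; split=> //; exact: lt_le_trans xs.
Qed.

Lemma green_equation t s : a <= t -> t <= b -> a < s -> s < b -> t != s ->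
  h n t s = - M * h 0 t s.
Proof.
have [_ [_ [_ [_ [_ [G6 _]]]]]] := gG; move=> at_ tb as_ sb ts.
have := G6 t s; rewrite !in_itv/= at_ as_ => /(_ tb sb ts) /eqP.
by rewrite addr_eq0 -mulNr => /eqP.
Qed.

Lemma green_conditions s : a < s -> s < b -> conditions a b A B n (fun i => h i ^~ s).
Proof.
have [_ [_ [_ [_ [_ [_ G7]]]]]] := gG; move=> as_ sb.
by apply: boundary_conditions_nat; apply: G7; rewrite in_itv/= as_.
Qed.

Lemma green_chain s : a <= s -> s <= b -> chain a b s n.-1 (fun i => h i ^~ s).
Proof.
move=> as_ sb i i_n; split.
  by apply: green_continuous_fst => //; exact: lt_pred.
by move=> t ta tb ts; apply: green_is_derive => //; exact: leq_trans (leq_pred n).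
Qed.

(** Here [M = w * m], so M lies on the side of 0 opposite to the parametrization [- (w * m)] used
    for positivity. Any interior s serves; the midpoint is taken. *)
Lemma green_contradicts_sign i0 m : A i0 -> 0 < m -> M = w * m ->
  ~ (forall t s, a <= t -> t <= b -> a <= s -> s <= b -> (q = n.-1 -> t != s) ->
       0 <= nu * h q t s).
Proof.
move=> Ai0 m0 ME hq; pose s := (a + b) / 2.
have [as_ sb] : a < s /\ s < b by split; rewrite midf_lt.
have [_ [_ [_ [_ [G5 _]]]]] := gG.
have [lp [lm [clp clm jump]]] : exists lp lm : R,
  [/\ h n.-1 t s @[t --> s^'+] --> lp, h n.-1 t s @[t --> s^'-] --> lm & lp - lm = 1].
  by apply: G5; rewrite in_itv/= as_.
have cn := green_conditions as_ sb.
apply: (wrong_sign_green ab q_gt0 q_lt A_lt B_ge tails total m0 as_ sb Ai0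
  (green_chain (ltW as_) (ltW sb)) _ _ _ _ _ clp clm jump) => //.
- by apply: conditions_le cn; exact: leq_pred.
- by move=> t ta tb ts; apply: green_is_derive_top => //; exact: ltW.
- by move=> x sx xb; apply: green_continuous_above => //; exact: ltW.
- exact: cn.2.
- by move=> t ta tb ts; rewrite green_equation ?ltW// ME mulNr.
- by move=> t ta tb ts; apply: hq => //; exact: ltW.
Qed.

Lemma green_bounded : exists2 C : R, 0 <= C & forall t s, a <= t -> t <= b ->
  a <= s -> s <= b -> `|M * h 0 t s| <= C.
Proof.
have [_ [G2 _]] := gG; have c0 := G2 0%N n_ge2.
have cK : compact (`[a, b] `*` `[a, b] : set (R * R)).
  by apply: compact_setX; exact: segment_compact.
have /compact_bounded[C [_ HC]] := continuous_compact c0 cK.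
exists (`|M| * (Num.max 0 C + 1)).
  by rewrite mulr_ge0// addr_ge0// le_max lexx.
move=> t s ta tb as_ sb; rewrite normrM ler_wpM2l//; apply: HC.
  by rewrite (@le_lt_trans _ _ (Num.max 0 C))// ?le_max ?lexx ?orbT// ltrDl.
by exists (t, s) => //=; rewrite !in_itv/= ta tb as_ sb.
Qed.

(* The jump at [s] and the condition at [b] bound the derivative of order n-1 to the
   left of [s]; for [s] tending to [b] it takes the value -1 at [b]. *)
Lemma green_top_estimate : exists2 C : R, 0 <= C & forall t, a <= t -> t < b ->
  `|h n.-1 t b + 1| <= C * (b - t).
Proof.
have [C C0 HC] := green_bounded; exists C => // t at_ tb.
have inner s : t < s -> s < b -> `|h n.-1 t s + 1| <= C * (b - t).
  move=> ts sb; have as_ := le_lt_trans at_ ts.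
  have [_ [_ [_ [_ [G5 _]]]]] := gG.
  have [lp [lm [clp clm jump]]] : exists lp lm : R,
    [/\ h n.-1 t s @[t --> s^'+] --> lp, h n.-1 t s @[t --> s^'-] --> lm & lp - lm = 1].
    by apply: G5; rewrite in_itv/= as_.
  have hb : h n.-1 b s = 0.
    exact: (green_conditions as_ sb).2.
  have bound_n x : a <= x -> x <= b -> x != s -> `|h n x s| <= C.
    by move=> ax xb xs; rewrite green_equation// mulNr normrN; apply: HC => //; exact: ltW.
  have above x : s < x -> x < b -> `|h n.-1 x s| <= C * (b - s).
    move=> sx xb; have ax := lt_trans as_ sx.
    have -> : `|h n.-1 x s| = `|h n.-1 b s - h n.-1 x s| by rewrite hb sub0r normrN.
    apply: (@le_trans _ _ (C * (b - x))).
      apply: (mean_value_bound (f := h n.-1 ^~ s) (f' := h n ^~ s)) => //.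
      - by apply: green_continuous_above => //; exact: ltW.
      - move=> v xv vb; apply: green_is_derive_top; rewrite ?ltW//.
          exact: lt_trans xv.
        by rewrite gt_eqF// (lt_trans sx).
      - move=> v xv vb; apply: bound_n; [exact/ltW/(lt_trans ax)|exact: ltW|].
        by rewrite gt_eqF// (lt_trans sx).
    by rewrite ler_wpM2l//; lra.
  have below x : t < x -> x < s -> `|h n.-1 t s - h n.-1 x s| <= C * (s - t).
    move=> tx xs; rewrite distrC; apply: (@le_trans _ _ (C * (x - t))).
      apply: (mean_value_bound (f := h n.-1 ^~ s) (f' := h n ^~ s)) => //.
      - apply: (within_itv_sub at_ (lexx x)).
        by apply: green_continuous_below => //; exact: ltW.
      - move=> v tv vx; apply: green_is_derive_top; rewrite ?ltW//.
        + exact: le_lt_trans tv.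
        + exact: lt_trans (lt_trans xs sb).
        + by rewrite lt_eqF// (lt_trans vx).
      - move=> v tv vx; apply: bound_n.
        + exact: le_trans (ltW tv).
        + by rewrite ltW// (lt_trans vx)// (lt_trans xs).
        + by rewrite lt_eqF// (lt_trans vx).
    by rewrite ler_wpM2l//; lra.
  (* The jump is given only through one-sided limits, so points x < s < y are taken where these are
     attained up to e/2. *)
  apply/ler_addgt0Pr => e e0.
  have e2 : 0 < e / 2 by rewrite divr_gt0.
  near s^'- => x; near s^'+ => y.
  have tx : t < x by near: x; exact: nbhs_left_gt.
  have xs : x < s by near: x; exact: nbhs_left_lt.
  have sy : s < y by near: y; exact: nbhs_right_gt.
  have yb : y < b by near: y; exact: nbhs_right_lt.
  have xe : `|lm - h n.-1 x s| < e / 2 by near: x; move/cvgrPdist_lt: clm; exact.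
  have ye : `|lp - h n.-1 y s| < e / 2 by near: y; move/cvgrPdist_lt: clp; exact.
  (* The jump turns 1 into [lp - lm]; the parts are then bounded by C (s - t), twice e/2, and C (b -
     s). *)
  have -> : h n.-1 t s + 1 = (h n.-1 t s - h n.-1 x s) - (lm - h n.-1 x s) +
      (lp - h n.-1 y s) + h n.-1 y s by rewrite -jump; ring.
  rewrite (le_trans (ler_normD _ _))//.
  have := ler_normD (h n.-1 t s - h n.-1 x s - (lm - h n.-1 x s)) (lp - h n.-1 y s).
  have := ler_normB (h n.-1 t s - h n.-1 x s) (lm - h n.-1 x s).
  by have := above y sy yb; have := below x tx xs; lra.
(* For [s] in [x, b] the point (t, s) stays in the triangle t < s, which contains s = b, so both
   weak bounds pass to the limit. *)
pose x := (t + b) / 2; have [tx xb] : t < x /\ x < b by split; rewrite midf_lt.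
have ch := green_continuous_below_snd top1 at_ tx.
have ge0 (d : R) : `|d| = 1 -> 0 <= (C * (b - t) + d) + d * h n.-1 t b.
  move=> d1; have cf := within_affine (c := C * (b - t) + d) (d := d) ch.
  have H := ge0_itv_closure (s := x) xb cf; apply: (H _ b) => //; last exact: ltW.
  move=> s xs sb _; have := inner s (lt_trans tx xs) sb.
  have -> : C * (b - t) + d + d * h n.-1 t s = C * (b - t) + d * (h n.-1 t s + 1) by ring.
  have : `|d * (h n.-1 t s + 1)| = `|h n.-1 t s + 1| by rewrite normrM d1 mul1r.
  by move=> <-; rewrite ler_norml; lra.
have := ge0 1 (normr1 _); have := ge0 (-1) (normrN1 _).
by rewrite ler_norml; lra.
Unshelve. all: by end_near. Qed.

Lemma limit_zero (v : R) (f : R -> R) : v < b -> {within `[v, b], continuous f} ->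
  (forall s, v < s -> s < b -> f s = 0) -> f b = 0.
Proof. by move=> vb cf f0; apply: (zero_closure vb cf f0) => //; exact: ltW. Qed.

(** At s = b the given Green's function supplies the comparison function of [eigenfunction_eq0], and
    an eigenfunction for mu <= m would vanish. The boundary conditions and the equation reach s = b
    by continuity in s. *)
Lemma green_excludes_eigenvalue m mu : 0 <= mu -> mu <= m -> M = - (w * m) ->
  is_eigenvalue a b SA SB (- (w * mu)) ->
  ~ (forall t s, a <= t -> t <= b -> a <= s -> s <= b -> (q = n.-1 -> t != s) ->
       0 <= nu * h q t s).
Proof.
move=> mu0 mum ME [u [[uC ubc] [t0 t0I ut0] ueq]] hq.
have [C C0 top] := green_top_estimate.
(* The corner (b, b) lies on the diagonal, where [is_green] leaves order n-1 unconstrained; its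
   limit -1 is put in instead. *)
pose y i t := if (i == n.-1) && (t == b) then -1 else h i t b.
have yE i t : t < b -> y i t = h i t b by move=> tb; rewrite /y (lt_eqF tb) andbF.
have yE' i t : (i != n.-1) -> y i t = h i t b by move=> /negbTE i_n; rewrite /y i_n.
have chy : chain a b b n y.
  move=> i i_n; split; last first.
    move=> t ta tb _; rewrite (yE _ _ tb).
    apply: near_eq_is_derive (green_is_derive i_n ta tb (ltW ab) (lexx b) _); last first.
      by rewrite lt_eqF.
    have tI : t \in `]a, b[%R by rewrite in_itv/= ta.
    by apply: filterS (near_in_itvoo tI) => x; rewrite in_itv/= => /andP[_ xb]; rewrite yE.
  have [i_top|i_top] := eqVneq i n.-1; last first.
    apply: continuous_within_congr (green_continuous_fst (i := i) _ (ltW ab) (lexx b)).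
      by move=> x _ _; rewrite yE'.
    by apply: lt_pred; rewrite ltn_neqAle i_top -ltnS n1.
  (* At t = b continuity is [green_top_estimate]; before b it comes from the triangle t < s. *)
  apply/continuous_withinP => t ta; rewrite le_eqVlt => /predU1P[->|tb] e e0.
    have C1 : 0 < C + 1 by rewrite ltr_wpDl.
    exists (e / (C + 1)); first by rewrite divr_gt0.
    move=> x ax; rewrite le_eqVlt => /predU1P[->|xb].
      by move=> _; rewrite subrr normr0.
    rewrite ltr_pdivlMr// => xe; rewrite (yE _ _ xb) /y i_top !eqxx/=.
    rewrite -opprD normrN addrC (le_lt_trans (top x ax xb))// (le_lt_trans _ xe)//.
    rewrite distrC gtr0_norm ?subr_gt0// mulrC ler_wpM2l ?subr_ge0 ?(ltW xb)//.
    by rewrite lerDl.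
  pose x := (t + b) / 2; have [tx xb] : t < x /\ x < b by split; rewrite midf_lt.
  have := green_continuous_below top1 xb (lexx b); rewrite -i_top.
  move=> /continuous_withinP/(_ t ta (ltW tx) e e0)[d d0 Hd].
  exists (Num.min d (x - t)); first by rewrite lt_min d0 subr_gt0.
  move=> v va vb; rewrite lt_min => /andP[vd vx].
  have {}vx : v < x by rewrite -(ltrD2r (- t)); exact: le_lt_trans (ler_norm _) vx.
  by rewrite !yE//; [apply: Hd => //; exact: ltW|exact: lt_trans xb].
have cy : conditions a b A B n.-1 y.
  split => i i_n Ci; rewrite yE' ?ltn_eqF//; have i_n' := ltnW (lt_pred i_n).
    apply: (limit_zero (f := h i a) ab).
      by apply: green_continuous_snd; rewrite ?lt_pred// ltW.
    by move=> s as_ sb; exact: (green_conditions as_ sb).1.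
  apply: (limit_zero (f := h i b) ab).
    by apply: green_continuous_snd; rewrite ?lt_pred// ltW.
  by move=> s as_ sb; exact: (green_conditions as_ sb).2.
have yb : y n.-1 b = -1 by rewrite /y !eqxx.
have yn t : a < t -> t < b -> y n t = w * m * y 0%N t.
  move=> ta tb; rewrite !yE//; apply/eqP; rewrite -subr_eq0; apply/eqP.
  pose x := (t + b) / 2; have [tx xb] : t < x /\ x < b by split; rewrite midf_lt.
  have cn := green_continuous_below_snd top2 (ltW ta) tx.
  have c0 : {within `[x, b], continuous (h 0 t)}.
    apply: (within_itv_sub _ (lexx b) (green_continuous_snd n_ge2 (ltW ta) (ltW tb))).
    exact: ltW (lt_trans ta tx).
  apply: (limit_zero (f := fun s => h n t s - w * m * h 0 t s) xb).
    move=> s; apply: cvgB; first exact: cn.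
    by apply: cvgM; [exact: cvg_cst|exact: c0].
  move=> s xs sb; have ts := lt_trans tx xs.
  by rewrite green_equation ?ltW// ?lt_eqF// ?(lt_trans ta)// ME opprK subrr.
have yq t : a < t -> t < b -> 0 <= nu * y q t.
  move=> ta tb; rewrite yE//; apply: hq; rewrite ?lexx ?ltW//.
  by rewrite lt_eqF.
have chu := Cn_chain uC; have cu := boundary_conditions_nat ubc.
have un t : a < t -> t < b ->
    deriven_within a b n u t = w * mu * deriven_within a b 0 u t.
  move=> ta tb; have := ueq t; rewrite in_itv/= !ltW// => /(_ isT)/eqP.
  by rewrite addr_eq0 mulNr opprK => /eqP.
have := eigenfunction_eq0 ab q_gt0 q_lt B_ge tails total mu0 mum chy cy yb yn yq chu cu un.
move: t0I; rewrite in_itv/= => /andP[ta tb] /(_ t0 ta tb) /= u0.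
by move: ut0; rewrite u0 eqxx.
Qed.

End GivenGreenFunction.

(** * Dependence on the parameter *)

Section ParameterDependence.
Context {R : realType}.
Variables (a b : R).
Implicit Types (M t : R) (f g : R -> R -> R).

Definition uniformly_near M0 f := forall e, 0 < e -> \forall M \near M0,
  forall t, a <= t -> t <= b -> `|f M t - f M0 t| <= e.

Lemma uniformly_near_cst M0 (x : R -> R) : x M @[M --> M0] --> x M0 ->
  uniformly_near M0 (fun M _ => x M).
Proof.
move=> /cvgrPdist_lt cx e /cx; apply: filterS => M xM t _ _.
by rewrite distrC ltW.
Qed.

Lemma uniformly_nearD M0 f g : uniformly_near M0 f -> uniformly_near M0 g ->
  uniformly_near M0 (fun M t => f M t + g M t).
Proof.
move=> uf ug e e0; have e2 : 0 < e / 2 by rewrite divr_gt0.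
apply: filterS2 (uf _ e2) (ug _ e2) => M fM gM t ta tb.
have -> : f M t + g M t - (f M0 t + g M0 t) = (f M t - f M0 t) + (g M t - g M0 t) by ring.
by rewrite (le_trans (ler_normD _ _))// [leRHS]splitr lerD ?fM ?gM.
Qed.

Lemma uniformly_nearN M0 f : uniformly_near M0 f -> uniformly_near M0 (fun M t => - f M t).
Proof.
move=> uf e /uf; apply: filterS => M fM t ta tb.
by rewrite -opprD normrN; exact: fM.
Qed.

Lemma uniformly_nearM M0 f g (C : R) : 0 <= C ->
  (forall t, a <= t -> t <= b -> `|f M0 t| <= C) ->
  (forall t, a <= t -> t <= b -> `|g M0 t| <= C) ->
  uniformly_near M0 f -> uniformly_near M0 g ->
  uniformly_near M0 (fun M t => f M t * g M t).
Proof.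
move=> C0 fC gC uf ug e e0.
(* With d <= 1 the product of the two increments is at most d, and the three error terms add up to
   at most d (2C + 1). *)
pose d := Num.min 1 (e / (2 * C + 1)).
have C1 : 0 < 2 * C + 1 by rewrite ltr_wpDl// mulr_ge0.
have d0 : 0 < d by rewrite lt_min ltr01 divr_gt0.
have d1 : d <= 1 by rewrite ge_min lexx.
have de : d * (2 * C + 1) <= e by rewrite -ler_pdivlMr// ge_min lexx orbT.
apply: filterS2 (uf _ d0) (ug _ d0) => M fM gM t ta tb.
have {}fM := fM t ta tb; have {}gM := gM t ta tb.
have {}fC := fC t ta tb; have {}gC := gC t ta tb.
have -> : f M t * g M t - f M0 t * g M0 t = (f M t - f M0 t) * (g M t - g M0 t) +
   ((f M t - f M0 t) * g M0 t + f M0 t * (g M t - g M0 t)) by ring.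
rewrite (le_trans (ler_normD _ _))// !normrM.
have h1 : `|f M t - f M0 t| * `|g M t - g M0 t| <= d * 1.
  by apply: ler_pM => //; exact: le_trans d1.
have h2 : `|(f M t - f M0 t) * g M0 t + f M0 t * (g M t - g M0 t)| <= d * C + C * d.
  by rewrite (le_trans (ler_normD _ _))// !normrM lerD// ler_pM.
apply: le_trans de; apply: (le_trans (lerD h1 h2)).
by rewrite le_eqVlt; apply/orP; left; apply/eqP; ring.
Qed.

Lemma uniformly_near_sum (n : nat) M0 (F : 'I_n -> R -> R -> R) :
  (forall l, uniformly_near M0 (F l)) ->
  uniformly_near M0 (fun M t => \sum_(l < n) F l M t).
Proof.
move=> uF; elim: (index_enum _) => [|l r IH].
  by move=> e e0; near=> M; move=> t _ _; rewrite !big_nil subrr normr0 ltW.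
suff -> : (fun M t => \sum_(i <- l :: r) F i M t) =
    (fun M t => F l M t + \sum_(i <- r) F i M t) by exact: uniformly_nearD.
by apply/funext => M; apply/funext => t; rewrite big_cons.
Unshelve. all: by end_near. Qed.

Lemma near_bounded M0 : \forall M \near M0, `|M| <= `|M0| + 1.
Proof.
apply/nbhs_ballP; exists 1 => //= M; rewrite /ball/= => MM.
have := ler_normB M0 (M0 - M); rewrite opprB addrC subrK; lra.
Qed.

Lemma uniformly_near_kernel M0 n j :
  uniformly_near M0 (fun M t => kernel M n j (t - b)).
Proof.
move=> e e0; have B1 : 1 <= `|M0| + 1 by rewrite lerDr.
have [C C0 HC] := kernel_lipschitz (b - a) n j B1.
have C1 : 0 < C + 1 by rewrite ltr_wpDl.
have eC : 0 < e / (C + 1) by rewrite divr_gt0.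
have near0 : \forall M \near M0, `|M0 - M| < e / (C + 1).
  by apply/nbhs_ballP; exists (e / (C + 1)).
apply: filterS2 (near_bounded M0) near0 => M MB; rewrite ltr_pdivlMr// distrC => MM t ta tb.
apply: le_trans (HC M M0 (t - b) MB _ _) _.
- by rewrite lerDl.
- by rewrite ler_norml; apply/andP; split; lra.
apply: le_trans (ltW MM); by rewrite ler_wpM2l// lerDl.
Qed.

Lemma cvg_kernel M0 n j t : kernel M n j t @[M --> M0] --> kernel M0 n j t.
Proof.
apply/cvgrPdist_lt => e e0; have B1 : 1 <= `|M0| + 1 by rewrite lerDr.
have [C C0 HC] := kernel_lipschitz `|t| n j B1.
have C1 : 0 < C + 1 by rewrite ltr_wpDl.
have near0 : \forall M \near M0, `|M0 - M| < e / (C + 1).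
  by apply/nbhs_ballP; exists (e / (C + 1)); rewrite //= divr_gt0.
apply: filterS2 (near_bounded M0) near0 => M MB; rewrite ltr_pdivlMr// => MM.
apply: le_lt_trans (HC M0 M t _ MB (lexx _)) _; first by rewrite lerDl.
by apply: le_lt_trans MM; rewrite ler_wpM2l// lerDl.
Qed.

Variables (n : nat) (c : 'I_n -> bool * 'I_n).

(* Derivative of order [i] of the Green's function at s = b. *)
Definition edge M i t : R := solution b M (green_coef a b c M b) i t - kernel M n i (t - b).

Lemma uniformly_near_edge M0 i : \det (boundary_matrix a b c M0) != 0 ->
  uniformly_near M0 (edge ^~ i).
Proof.
move=> d0; apply: uniformly_nearD; last exact/uniformly_nearN/uniformly_near_kernel.
apply: uniformly_near_sum => l.
have ck : {within `[a, b], continuous (fun t => kernel M0 n (n.-1 - l + i) (t - b))}.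
  apply: continuous_subspaceT => t.
  apply: (@cvg_comp _ _ _ (fun t => t - b)); last exact: continuous_kernel.
  by apply: cvgB; [exact: cvg_id|exact: cvg_cst].
have [C C0 HC] := bounded_within ck.
pose x M := green_coef a b c M b 0 l.
have x0 : 0 <= `|x M0| + C by rewrite addr_ge0// ltW.
apply: (uniformly_nearM (f := fun M _ => x M) x0).
- by move=> t _ _; rewrite lerDl ltW.
- by move=> t ta tb; rewrite (le_trans (HC t ta tb))// lerDr.
- apply: uniformly_near_cst; apply: cvg_green_coef => //; move=> *; exact: cvg_kernel.
- exact: uniformly_near_kernel.
Qed.

End ParameterDependence.

(** * Positivity of the Green's function for parameters before the first eigenvalue *)

Section Positivity.
Context {R : realType}.
Variables (a b : R) (n q : nat) (A B : nat -> bool) (SA SB : {set 'I_n}).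
Hypotheses (ab : a < b) (n_ge2 : (2 <= n)%N) (q_gt0 : (0 < q)%N) (q_lt : (q < n)%N).
Hypothesis A_lt : forall i, A i -> (i < q)%N.
Hypothesis B_ge : forall i, (q <= i < n)%N -> B i.
Hypothesis tails :
  forall i, (i <= q)%N -> (\sum_(i <= j < q) (A j + B j) <= q - i)%N.
Hypothesis total : (\sum_(0 <= j < q) (A j + B j))%N = q.
Hypothesis A_ord : forall o : 'I_n, A o = (o \in SA).
Hypothesis B_ord : forall o : 'I_n, B o = (o \in SB).
Variable c : 'I_n -> bool * 'I_n.
Hypothesis cP : forall side (i : 'I_n),
  (i \in if side then SA else SB) <-> exists r, c r = (side, i).
Implicit Types (s t x M m mu : R) (i j : nat) (u : R -> R).

Let nu : R := (-1) ^+ (n - q).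
Let w : R := (-1) ^+ (\sum_(0 <= j < q) ~~ A j + (n - q))%N.

Let n_gt0 : (0 < n)%N. Proof. exact: ltnW. Qed.

Let n1 : (n.-1.+1 = n)%N. Proof. by rewrite prednK. Qed.

Let n1_lt : (n.-1 < n)%N. Proof. by rewrite n1. Qed.

Let q_le : (q <= n.-1)%N. Proof. by rewrite -ltnS n1. Qed.

Let lt_pred i : (i < n.-1)%N -> (i.+1 < n)%N. Proof. by rewrite -ltnS n1. Qed.

Let B_top : B n.-1. Proof. by apply: B_ge; rewrite n1_lt q_le. Qed.

Let kernel_chain M s N : chain a b b N (fun i t => kernel M n i (t - s)).
Proof.
move=> i _; split.
  apply: continuous_subspaceT => t.
  apply: (@cvg_comp _ _ _ (fun t => t - s)); last exact: continuous_kernel.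
  by apply: cvgB; [exact: cvg_id|exact: cvg_cst].
by move=> t _ _ _; apply: is_derive_shift; exact: is_derive_kernel.
Qed.

Let solution_chain M (x : 'rV[R]_n) N : chain a b b N (solution b M x).
Proof.
move=> i _; split; first exact/continuous_subspaceT/continuous_solution.
by move=> t _ _ _; exact: is_derive_solution.
Qed.

Let left_chain M (x : 'rV[R]_n) s N :
  chain a b b N (fun i t => solution b M x i t - kernel M n i (t - s)).
Proof.
have := chain_lin 1 (-1) (@solution_chain M x N) (@kernel_chain M s N).
by congr chain; apply/funext => i; apply/funext => t; rewrite mul1r mulN1r.
Qed.

Let left_period M (x : 'rV[R]_n) s t :
  solution b M x n t - kernel M n n (t - s) =
  - M * (solution b M x 0 t - kernel M n 0 (t - s)).
Proof.
have := solution_period b n_gt0 M x 0 t; rewrite add0n => ->.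
by have := kernel_period M 0 (t - s) n_gt0; rewrite add0n => ->; rewrite mulrBr.
Qed.

Let kernel_top M : kernel M n n.-1 0 = 1.
Proof. by rewrite kernel0 /kernel_coeff n1 dvdnn divnn n_gt0. Qed.

(** [edge] keeps the full kernel at t = b, so order n-1 takes its left limit there: 0 from the
    condition at b, minus E^(n-1)(0) = 1. In lower orders E vanishes at 0 and the conditions
    survive. *)
Lemma edge_conditions M : \det (boundary_matrix a b c M) != 0 ->
  conditions a b A B n.-1 (edge a b c M) /\ edge a b c M n.-1 b = -1.
Proof.
move=> d0; split; first split.
- move=> i i_n Ai; have i_lt := ltnW (lt_pred i_n).
  have iA : Ordinal i_lt \in SA by rewrite -A_ord.
  by rewrite /edge (green_solution_left cP (i := Ordinal i_lt) b d0 iA) subrr.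
- move=> i i_n Bi; have i_lt := ltnW (lt_pred i_n).
  have iB : Ordinal i_lt \in SB by rewrite -B_ord.
  rewrite /edge (green_solution_right cP (i := Ordinal i_lt) b d0 iB)/= subrr kernel0.
  by rewrite /kernel_coeff gtnNdvd ?lt_pred// subrr.
- have iB : Ordinal n1_lt \in SB by rewrite -B_ord.
  rewrite /edge (green_solution_right cP (i := Ordinal n1_lt) b d0 iB)/= subrr.
  by rewrite kernel_top sub0r.
Qed.

Definition edge_nonneg m :=
  forall t, a < t -> t < b -> 0 <= nu * edge a b c (- (w * m)) q t.

Let edge_equation m t : edge a b c (- (w * m)) n t = w * m * edge a b c (- (w * m)) 0 t.
Proof. by rewrite /edge left_period opprK. Qed.

Let weight_gt0 t : t < b -> 0 < (b - t) ^+ (n.-1 - q) / (n.-1 - q)`!%:R.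
Proof. by move=> tb; rewrite divr_gt0 ?exprn_gt0 ?subr_gt0// ltr0n fact_gt0. Qed.

(** At m = 0 the derivative of order n-1 is the constant -1, and integration from b gives the
    sign. *)
Lemma edge_nonneg0 : \det (boundary_matrix a b c 0) != 0 -> edge_nonneg 0.
Proof.
rewrite /edge_nonneg mulr0 oppr0 => d0 t ta tb.
have [cy yb] := edge_conditions d0.
have ch := @left_chain 0 (green_coef a b c 0 b) b n.
have ch' := chain_weaken (leq_pred n) (lexx a) (lexx b) (fun t _ _ => id) ch.
have [cn dn] := ch n.-1 n1_lt.
have top x : a < x -> x < b -> x != b -> edge a b c 0 n.-1 x <= -1.
  move=> xa xb _; rewrite -[X in _ <= X]yb.
  apply: (le_of_derive_ge0 cn dn); rewrite ?lexx ?ltW// => v va vb _.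
  by rewrite n1 left_period oppr0 mul0r.
have tNb : t != b by rewrite lt_eqF.
have := lower_from_top q_lt B_ge ch' cy top ta tb tNb.
by rewrite mul1r; apply: le_trans; exact/ltW/weight_gt0.
Qed.

(** The data -1 cancel in the difference of the two edges, so at order q it is at most half the
    weight, whereas the edge at [m] is at least the weight. *)
Lemma edge_nonneg_close m m' : 0 <= m ->
  \det (boundary_matrix a b c (- (w * m))) != 0 ->
  \det (boundary_matrix a b c (- (w * m'))) != 0 ->
  (forall t, a <= t -> t <= b ->
    `|edge a b c (- (w * m')) n.-1 t - edge a b c (- (w * m)) n.-1 t| <= 2^-1) ->
  edge_nonneg m -> edge_nonneg m'.
Proof.
move=> m0 d0 d0' close good t ta tb.
have [cy yb] := edge_conditions d0; have [cy' _] := edge_conditions d0'.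
have ch := @left_chain (- (w * m)) (green_coef a b c (- (w * m)) b) b n.
have ch' := @left_chain (- (w * m')) (green_coef a b c (- (w * m')) b) b n.
have chD := chain_weaken (leq_pred n) (lexx a) (lexx b) (fun t _ _ => id)
  (chain_lin 1 (-1) ch' ch).
have [_ _ low] := solution_lower ab q_gt0 q_lt B_ge tails total m0 ch cy yb
  (fun t _ _ => edge_equation m t) good.
have cD := conditions_lin 1 (-1) cy' cy.
have top x : a < x -> x < b -> x != b ->
    `|1 * edge a b c (- (w * m')) n.-1 x + -1 * edge a b c (- (w * m)) n.-1 x| <= 2^-1.
  by move=> xa xb _; rewrite mul1r mulN1r; apply: close; exact: ltW.
have tNb : t != b by rewrite lt_eqF.
have := bound_from_top q_lt B_ge chD cD top ta tb tNb.
rewrite mul1r mulN1r => H.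
have := low t ta tb; have := weight_gt0 tb.
have : `|nu * (edge a b c (- (w * m')) q t - edge a b c (- (w * m)) q t)| <=
    2^-1 * ((b - t) ^+ (n.-1 - q) / (n.-1 - q)`!%:R) by rewrite normrM normr_sign mul1r.
rewrite ler_norml mulrBr -/nu => /andP[+ _].
move: (nu * _) (nu * _) (_ / _) => x y z; lra.
Qed.

(** Openness and closedness at once: nonnegativity persists by [edge_nonneg_close], and failure
    persists because one strictly negative value does. *)
Lemma edge_nonneg_locally_constant m : 0 <= m ->
  \det (boundary_matrix a b c (- (w * m))) != 0 ->
  exists2 d, 0 < d & forall m', 0 <= m' ->
    \det (boundary_matrix a b c (- (w * m'))) != 0 ->
    `|m' - m| < d -> (edge_nonneg m <-> edge_nonneg m').
Proof.
move=> m0 d0.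
have near_m (P : R -> Prop) : (\forall M \near - (w * m), P M) ->
    exists2 d, 0 < d & forall m', `|m' - m| < d -> P (- (w * m')).
  move=> /nbhs_ballP[d /= dpos Hd]; exists d => // m' mm; apply: Hd.
  rewrite /ball/=; have -> : - (w * m) - - (w * m') = w * (m' - m) by ring.
  by rewrite normrM normr_sign mul1r.
have half0 : 0 < 2^-1 :> R by rewrite invr_gt0.
have [d dpos Hd] := near_m _ (uniformly_near_edge n.-1 d0 half0).
have [good|bad] := pselect (edge_nonneg m).
  by exists d => // m' m'0 d0' mm; split => // _; apply: edge_nonneg_close good => //; exact: Hd.
have [t [ta tb neg]] : exists t, [/\ a < t, t < b & nu * edge a b c (- (w * m)) q t < 0].
  apply: contrapT => H; apply: bad => t ta tb; rewrite leNgt; apply/negP => neg.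
  by apply: H; exists t.
(* Half the defect at [t]: a change of at most this size leaves the value negative. *)
pose e := - (nu * edge a b c (- (w * m)) q t) / 2.
have e0 : 0 < e by rewrite divr_gt0// oppr_gt0.
have [d' d'pos Hd'] := near_m _ (uniformly_near_edge q d0 e0).
exists d' => // m' m'0 d0' mm; split => // good; exfalso.
have := good t ta tb; have := Hd' m' mm t (ltW ta) (ltW tb).
have <- : `|nu * (edge a b c (- (w * m')) q t - edge a b c (- (w * m)) q t)| =
    `|edge a b c (- (w * m')) q t - edge a b c (- (w * m)) q t|.
  by rewrite normrM normr_sign mul1r.
rewrite ler_norml mulrBr => /andP[_]; move: neg; rewrite /e.
by move: (nu * _) (nu * _) => x y; lra.
Qed.

(** Connectedness of [0, v], through the supremum of the initial segments on which [P] holds. *)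
Lemma locally_constant_itv (P : R -> Prop) (v : R) : 0 <= v -> P 0 ->
  (forall m, 0 <= m -> m <= v -> exists2 d, 0 < d & forall m', 0 <= m' -> m' <= v ->
     `|m' - m| < d -> (P m <-> P m')) -> P v.
Proof.
move=> v0 P0 loc.
pose E := [set m | [/\ 0 <= m, m <= v & forall m', 0 <= m' -> m' <= m -> P m']].
have E0 : E 0 by split => // m' m'0 m'le; have -> : m' = 0 by apply/eqP; rewrite eq_le m'le.
have ubE : ubound E v by move=> m [].
have supE : has_sup E by split; [exists 0|exists v].
have s0 : 0 <= sup E by apply: (sup_upper_bound supE).
have sv : sup E <= v by apply: ge_sup => //; exists 0.
have [d d0 Hd] := loc (sup E) s0 sv.
have [m Em mlt] := sup_adherent d0 supE.
have mle := sup_upper_bound supE Em.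
have [m0 mv Pm] := Em.
have Ps : P (sup E).
  apply/(Hd m m0 mv); last exact: Pm.
  by rewrite distrC ger0_norm ?subr_ge0//; lra.
pose m1 := Num.min v (sup E + d / 2).
have Em1 : E m1.
  split; first by rewrite le_min v0/= addr_ge0// divr_ge0// ltW.
    by rewrite ge_min lexx.
  move=> m' m'0; rewrite le_min => /andP[m'v m'd].
  have [m'm|mm'] := leP m' m; first exact: Pm.
  by apply/(Hd m' m'0 m'v) => //; rewrite ltr_norml; apply/andP; split; lra.
have := sup_upper_bound supE Em1; rewrite /m1 ge_min => /orP[vs|]; last by lra.
by have -> : v = sup E by apply/eqP; rewrite eq_le vs sv.
Qed.

Lemma edge_nonneg_below (mu m : R) : 0 <= m -> m < mu ->
  (forall m', 0 <= m' -> m' < mu -> \det (boundary_matrix a b c (- (w * m'))) != 0) ->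
  edge_nonneg m.
Proof.
move=> m0 mmu dets; apply: (@locally_constant_itv edge_nonneg) => //.
  apply: edge_nonneg0; have := dets 0 (lexx 0) (le_lt_trans m0 mmu).
  by rewrite mulr0 oppr0.
move=> v v0 vm; have [d dpos Hd] := edge_nonneg_locally_constant v0 (dets v v0 (le_lt_trans vm mmu)).
exists d => // m' m'0 m'm; apply: Hd => //; apply: dets => //; exact: le_lt_trans mmu.
Qed.

Lemma green_nonneg m : 0 <= m -> \det (boundary_matrix a b c (- (w * m))) != 0 ->
  edge_nonneg m ->
  forall t s, a <= t -> t <= b -> a <= s -> s <= b -> (q = n.-1 -> t != s) ->
    0 <= nu * dt a b q (green_deriv a b c (- (w * m)) 0) t s.
Proof.
move=> m0 d0 good t s ta tb as_ sb ts.
set M := - (w * m) in d0 good *.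
have ok : (q.+1 < n)%N || (t != s).
  move: q_le; rewrite leq_eqVlt => /predU1P[qn|]; first by rewrite ts ?orbT.
  by move=> /lt_pred ->.
rewrite dt_green//.
have [cy yb] := edge_conditions d0.
pose x := green_coef a b c M s; pose z i t := green_deriv a b c M i t s.
have half_cont i : (i < n.-1)%N -> continuous (z i).
  move=> i_n v; apply: cvgB; first exact: continuous_solution.
  apply: (@cvg_comp _ _ _ (fun t => t - s)).
    by apply: cvgB; [exact: cvg_id|exact: cvg_cst].
  exact/continuous_half_kernel/lt_pred.
have chz : chain a b s n.-1 z.
  move=> i i_n; split; first exact/continuous_subspaceT/half_cont.
  by move=> v va vb vs; apply: is_derive_green; rewrite vs orbT.
have cz : conditions a b A B n.-1 z.
  split => i i_n Ci; have i_lt := ltnW (lt_pred i_n).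
    have iA : Ordinal i_lt \in SA by rewrite -A_ord.
    by apply: (green_left cP (i := Ordinal i_lt)) => //=; rewrite lt_pred.
  have iB : Ordinal i_lt \in SB by rewrite -B_ord.
  exact: (green_right cP (i := Ordinal i_lt)).
have zl i v : v < s -> z i v = solution b M x i v - kernel M n i (v - s).
  by move=> vs; rewrite /z /green_deriv /half_kernel subr_lt0 vs.
have zr i v : s <= v -> z i v = solution b M x i v.
  by move=> sv; rewrite /z /green_deriv /half_kernel subr_lt0 ltNge sv subr0.
have chl := @left_chain M x s n; have chr := @solution_chain M x n.
have iB : Ordinal n1_lt \in SB by rewrite -B_ord.
have interior v : a < v -> v < b -> v != s -> 0 <= nu * z q v.
  apply: (green_positive ab q_gt0 q_lt B_ge tails total m0
    (@left_chain M (green_coef a b c M b) b n) cy yb _ good as_ sb chz cz chl chr) => //.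
  - by move=> u _ _; exact: edge_equation.
  - by move=> i u su; apply: zr; exact: ltW.
  - by move=> u _ _; rewrite left_period opprK.
  - move=> u _ _; have := solution_period b n_gt0 M x 0 u; rewrite add0n => ->.
    by rewrite opprK.
  - exact: (green_solution_right cP (i := Ordinal n1_lt) s d0 iB).
  - by rewrite subrr kernel_top.
have scaled (f : R -> R) (u v : R) : {within `[u, v], continuous f} ->
    {within `[u, v], continuous (fun t => nu * f t)}.
  move=> /subspace_continuousP cf; apply/subspace_continuousP => k kuv.
  by apply: cvgM; [exact: cvg_cst|exact: cf].
rewrite -[green_deriv _ _ _ _ _ _ _]/(z q t).
(* Below order n-1 the derivative is continuous across [s] and the sign extends to [a, b]. At order
   n-1 it jumps, and each smooth branch is closed up on its own side of [s]. *)
have [q_lt1|q_ge1] := ltnP q n.-1.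
  apply: (ge0_itv_closure (s := s) ab (scaled _ _ _ (chz q q_lt1).1)) => //.
have qn : q = n.-1 by apply/eqP; rewrite eqn_leq q_le.
have := ts qn; rewrite neq_lt => /orP[lt_ts|lt_st].
  rewrite zl//; have a_s := le_lt_trans ta lt_ts.
  have [cl _] := chl q q_lt.
  apply: (ge0_itv_closure (s := s) a_s (scaled _ _ _ (within_itv_sub (lexx a) sb cl))) => //.
    move=> v va vs vns; rewrite -zl//; apply: interior => //; exact: lt_le_trans sb.
  exact: ltW.
rewrite zr; last exact: ltW.
have s_b := lt_le_trans lt_st tb.
have [cr _] := chr q q_lt.
have H := ge0_itv_closure (s := s) s_b (scaled _ _ _ (within_itv_sub as_ (lexx b) cr)).
apply: (H _ t) => //.
  move=> v va vs vns; rewrite -zr; last exact: ltW.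
  by apply: interior => //; exact: le_lt_trans va.
exact: ltW.
Qed.

End Positivity.

(** * Characterization of the sign *)

Section Characterization.
Context {R : realType}.
Variables (a b : R) (n q : nat) (A B : nat -> bool) (SA SB : {set 'I_n}).
Hypotheses (ab : a < b) (n_ge2 : (2 <= n)%N) (q_gt0 : (0 < q)%N) (q_lt : (q < n)%N).
Hypothesis A_lt : forall i, A i -> (i < q)%N.
Hypothesis B_ge : forall i, (q <= i < n)%N -> B i.
Hypothesis tails :
  forall i, (i <= q)%N -> (\sum_(i <= j < q) (A j + B j) <= q - i)%N.
Hypothesis total : (\sum_(0 <= j < q) (A j + B j))%N = q.
Hypothesis A_ord : forall o : 'I_n, A o = (o \in SA).
Hypothesis B_ord : forall o : 'I_n, B o = (o \in SB).

Let nu : R := (-1) ^+ (n - q).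
Let w : R := (-1) ^+ (\sum_(0 <= j < q) ~~ A j + (n - q))%N.

(** If u^(n) = 0, the conditions at b of orders q to n-1 give u^(q) = 0, and the sign lemma for u
    and -u leaves only u = 0. *)
Lemma zero_not_eigenvalue : ~ is_eigenvalue a b SA SB (0 : R).
Proof.
move=> [u [[uC ubc] [t0 t0I ut0] ueq]].
have chu := Cn_chain uC; have cu := boundary_conditions_nat A_ord B_ord ubc.
have q_n : (q + (n - q) = n)%N by rewrite subnKC// ltnW.
have uq t : a < t -> t < b -> deriven_within a b q u t = 0.
  move=> ta tb; have tNb : t != b by rewrite lt_eqF.
  have chq := chu; rewrite -q_n in chq.
  apply/eqP; rewrite -normr_le0 -[X in _ <= X](mul0r ((b - t) ^+ (n - q) / (n - q)`!%:R)).
  rewrite -[in deriven_within _ _ q](addn0 q).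
  apply: (integrate_from_right_bound (chain_shift chq)) => //.
    move=> i ir; apply: cu.2; first by rewrite -[X in (_ < X)%N]q_n ltn_add2l.
    by apply: B_ge; rewrite leq_addr -[X in (_ < X)%N]q_n ltn_add2l.
  move=> x xa xb _; rewrite q_n; have xI : x \in `[a, b]%R by rewrite in_itv/= !ltW.
  by have := ueq x xI; rewrite mul0r addr0 => ->; rewrite normr0.
have sgn e t : a <= t -> t <= b -> 0 <= w * (e * u t + 0 * u t).
  have ch' := chain_weaken (leq_pred n) (lexx a) (lexx b) (fun t _ _ => id) chu.
  have cu' := conditions_le (leq_pred n) cu.
  apply: (@sign_from_q R a b n q A B ab q_gt0 q_lt tails total b
    (fun i t => e * deriven_within a b i u t + 0 * deriven_within a b i u t)).
  - exact: chain_lin.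
  - exact: conditions_lin.
  - by move=> x xa xb _; rewrite uq// !mulr0 addr0 mulr0.
move: t0I; rewrite in_itv/= => /andP[ta tb].
have := sgn 1 t0 ta tb; have := sgn (-1) t0 ta tb.
rewrite mul0r !addr0 mul1r mulN1r mulrN oppr_ge0 => l g.
have := le_anti (introT andP (conj l g)).
by move/eqP; rewrite mulf_eq0 signr_eq0 (negbTE ut0).
Qed.

(** The substitution m = - (w M) merges the parity cases into the single range 0 <= m < mu. The
    condition of order [i0] at a is what excludes m < 0. *)
Lemma green_sign_characterization (i0 : nat) (mu M : R) : A i0 ->
  (#|SA| + #|SB| = n)%N -> 0 < mu -> is_eigenvalue a b SA SB (- (w * mu)) ->
  (forall m, 0 < m -> m < mu -> ~ is_eigenvalue a b SA SB (- (w * m))) ->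
  green_deriv_sat a b M SA SB q (fun y => 0 <= nu * y) <-> 0 <= - (w * M) < mu.
Proof.
move=> Ai0 card mu0 eig_mu mu_min.
have ww : w * w = 1 by rewrite -expr2 sqrr_sign.
have ME : M = - (w * (- (w * M))) by rewrite mulrN opprK mulrA ww mul1r.
have not_eig m : 0 <= m -> m < mu -> ~ is_eigenvalue a b SA SB (- (w * m)).
  rewrite le_eqVlt => /predU1P[<- _|]; last exact: mu_min.
  by rewrite mulr0 oppr0; exact: zero_not_eigenvalue.
have [c cP] := enumerate_conditions card.
split => [[_ [g gG gP]]|/andP[m0 m_mu]].
  have gP' t s : a <= t -> t <= b -> a <= s -> s <= b -> (q = n.-1 -> t != s) ->
      0 <= nu * dt a b q g t s.
    by move=> ta tb as_ sb ts; apply: gP; rewrite // in_itv/= ?ta ?as_.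
  have [m_neg|m_pos] := ltP (- (w * M)) 0.
    have m_pos : 0 < w * M by rewrite -oppr_lt0.
    have ME' : M = w * (w * M) by rewrite mulrA ww mul1r.
    exfalso; exact: (green_contradicts_sign ab n_ge2 q_gt0 q_lt A_lt B_ge tails total
      A_ord B_ord gG Ai0 m_pos ME').
  rewrite ltNge; apply/negP => mu_le.
  exact: (green_excludes_eigenvalue ab n_ge2 q_gt0 q_lt B_ge tails total
    A_ord B_ord gG (ltW mu0) mu_le ME eig_mu).
have n_gt0 : (0 < n)%N := ltnW n_ge2.
have dets m' : 0 <= m' -> m' < mu -> \det (boundary_matrix a b c (- (w * m'))) != 0.
  by move=> m'0 m'mu; apply: (det_boundary_matrix ab n_gt0 cP); exact: not_eig.
rewrite ME; split; first exact: not_eig.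
have d0 := dets _ m0 m_mu.
exists (green_deriv a b c (- (w * - (w * M))) 0); first exact: is_green_green.
move=> t s; rewrite !in_itv/= => /andP[ta tb] /andP[as_ sb] ts.
apply: (green_nonneg ab n_ge2 q_gt0 q_lt B_ge tails total A_ord B_ord cP m0 d0) => //.
exact: (edge_nonneg_below ab n_ge2 q_gt0 q_lt B_ge tails total A_ord B_ord cP m0 m_mu dets).
Qed.

End Characterization.

(** * Counting the prescribed orders *)

Section IndexSets.
Variables (m n : nat) (f : 'I_m -> 'I_n).
Hypothesis f_incr : strictly_increasing f.

(** Membership in the index set, extended to all natural numbers so that it can be summed over
    ranges of orders. *)
Definition hits (i : nat) : bool := [exists j, (f j : nat) == i].

Lemma strictly_increasing_inj : injective f.
Proof.
move=> i j fij; apply/val_inj => /=.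
by case: (ltngtP i j) => // /f_incr; rewrite fij ltnn.
Qed.

Lemma hits_index_set (o : 'I_n) : hits o = (o \in index_set f).
Proof.
apply/existsP/imsetP => [[j /eqP fj]|[j _ ->]]; last by exists j.
by exists j => //; exact/esym/val_inj.
Qed.

Lemma sum_hits h : (\sum_(0 <= i < h) hits i)%N = nb_lt f h.
Proof.
have hitE (i : nat) : nat_of_bool (hits i) = (\sum_(j < m) ((f j : nat) == i))%N.
  case: (boolP (hits i)) => [/existsP[j /eqP fj]|nh].
    rewrite (bigD1 j)//= fj eqxx big1 ?addn0// => j' j'j; apply/eqP; rewrite eqb0.
    apply: contra j'j => /eqP fj'; apply/eqP/strictly_increasing_inj/val_inj.
    by rewrite /= fj fj'.
  rewrite big1// => j _; apply/eqP; rewrite eqb0; apply: contra nh => fj.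
  by apply/existsP; exists j.
under eq_bigr do rewrite hitE.
rewrite exchange_big /nb_lt -sum1_card [RHS]big_mkcond/=; apply: eq_bigr => j _.
rewrite unfold_in/= big_mkord; case: ltnP => [fh|hf].
  rewrite (bigD1 (Ordinal fh))//= eqxx big1 ?addn0// => i iN; apply/eqP.
  by rewrite eqb0; apply: contra iN => /eqP E; apply/eqP/val_inj.
rewrite big1// => i _; apply/eqP; rewrite eqb0; apply/negP => /eqP E.
by move: (ltn_ord i); rewrite -E ltnNge hf.
Qed.

Lemma nb_lt_ge h : (nb_lt f h + nb_ge f h)%N = m.
Proof.
rewrite /nb_lt /nb_ge -[RHS]card_ord -(cardC [pred j : 'I_m | (f j < h)%N]).
by congr addn; apply: eq_card => j; rewrite !inE -leqNgt.
Qed.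

Lemma card_index_set : #|index_set f| = m.
Proof. by rewrite card_imset ?card_ord//; exact: strictly_increasing_inj. Qed.

End IndexSets.

Unset Implicit Arguments.

Theorem theorem3p19 (R : realType) (a b : R) (n k q : nat)
    (sigma : 'I_k -> 'I_n) (eps : 'I_(n - k) -> 'I_n)
    (ltab : a < b) (n_ge2 : (2 <= n)%N)
    (k_range : (1 <= k <= n.-1)%N) (q_range : (1 <= q <= n.-1)%N)
    (sigma_incr : strictly_increasing sigma)
    (eps_incr : strictly_increasing eps)
    (Na : condition_Na sigma eps)
    (cdq : (nb_ge sigma q + nb_ge eps q = n - q)%N)
    (cq : nb_ge sigma q = 0%N)
    (dq : nb_ge eps q = (n - q)%N) :
  (~~ odd (n - k) ->
   forall lambda1 : R,
     is_biggest_negative_eigenvalue a b (index_set sigma) (index_set eps) lambda1 ->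
     (~~ odd (n - q) -> forall M : R,
        green_deriv_nonneg a b M (index_set sigma) (index_set eps) q <->
        lambda1 < M <= 0) /\
     (odd (n - q) -> forall M : R,
        green_deriv_nonpos a b M (index_set sigma) (index_set eps) q <->
        lambda1 < M <= 0)) /\
  (odd (n - k) ->
   forall lambda1 : R,
     is_least_positive_eigenvalue a b (index_set sigma) (index_set eps) lambda1 ->
     (~~ odd (n - q) -> forall M : R,
        green_deriv_nonneg a b M (index_set sigma) (index_set eps) q <->
        0 <= M < lambda1) /\
     (odd (n - q) -> forall M : R,
        green_deriv_nonpos a b M (index_set sigma) (index_set eps) q <->
        0 <= M < lambda1)).
Proof.
have /andP[k1 kn] := k_range; have /andP[q1 qn] := q_range.
have q_lt : (q < n)%N by lia.
pose A := hits sigma; pose B := hits eps.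
have sumA h : (\sum_(0 <= i < h) A i)%N = nb_lt sigma h by exact: sum_hits.
have sumB h : (\sum_(0 <= i < h) B i)%N = nb_lt eps h by exact: sum_hits.
have kE := nb_lt_ge sigma q; have nkE := nb_lt_ge eps q.
have A_lt i : A i -> (i < q)%N.
  move=> /existsP[j /eqP <-]; rewrite ltnNge; apply/negP => qj.
  by move/eqP: cq => /eqP/card0_eq/(_ j); rewrite !inE qj.
have total : (\sum_(0 <= j < q) (A j + B j))%N = q.
  by rewrite big_split/= sumA sumB; lia.
(* Condition (N_a) bounds the initial sums from below; subtracted from the total q, this bounds the
   tails from above. *)
have prefix i : (i <= q)%N -> (i <= \sum_(0 <= j < i) (A j + B j))%N.
  rewrite big_split/= sumA sumB; case: i => // i iq; apply: Na; lia.
have tails i : (i <= q)%N -> (\sum_(i <= j < q) (A j + B j) <= q - i)%N.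
  move=> iq; have := prefix i iq; have := total.
  by rewrite (big_cat_nat (n := i))//=; lia.
(* The n - q values of [eps] that are at least q are distinct and below n, so they fill the whole
   range. *)
have B_ge i : (q <= i < n)%N -> B i.
  have full : (\sum_(q <= j < n) B j = n - q)%N.
    have := sumB n; rewrite (big_cat_nat (n := q))//=; last exact: ltnW.
    rewrite sumB; have := nb_lt_ge eps n.
    have -> : nb_ge eps n = 0%N.
      by apply: eq_card0 => j; rewrite !inE leqNgt ltn_ord.
    lia.
  have : (\sum_(q <= j < n) ~~ B j = 0)%N.
    have : (\sum_(q <= j < n) (B j + ~~ B j) = n - q)%N.
      by rewrite -[RHS]muln1 -sum_nat_const_nat; apply: eq_bigr => j _; case: (B j).
    by rewrite big_split/= full; lia.
  move=> /eqP; rewrite sum_nat_seq_eq0 => /allP H iq.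
  by have := H i; rewrite mem_index_iota iq => /(_ isT); case: (B i).
(* All k conditions at a have order below q, so q - k orders there are free, and the exponent of [w]
   is n - k. *)
have K : (\sum_(0 <= j < q) ~~ A j + (n - q) = n - k)%N.
  have : (\sum_(0 <= j < q) (A j + ~~ A j) = q)%N.
    rewrite -[RHS]subn0 -[RHS]muln1 -sum_nat_const_nat.
    by apply: eq_bigr => j _; case: (A j).
  by rewrite big_split/= sumA; lia.
have card : (#|index_set sigma| + #|index_set eps| = n)%N.
  by rewrite !card_index_set// subnKC//; lia.
have A0 : A (sigma (Ordinal k1)) by apply/existsP; exists (Ordinal k1).
have main mu M := @green_sign_characterization R a b n q A B (index_set sigma)
  (index_set eps) ltab n_ge2 q1 q_lt A_lt B_ge tails total
  (hits_index_set sigma) (hits_index_set eps) _ mu M A0 card.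
rewrite K in main.
have nonnegE M : ~~ odd (n - q) -> green_deriv_nonneg a b M (index_set sigma) (index_set eps) q =
    green_deriv_sat a b M (index_set sigma) (index_set eps) q
      (fun y : R => 0 <= (-1) ^+ (n - q) * y).
  move=> /negbTE even_nq; congr green_deriv_sat; apply/funext => y.
  by rewrite -signr_odd even_nq mul1r.
have nonposE M : odd (n - q) -> green_deriv_nonpos a b M (index_set sigma) (index_set eps) q =
    green_deriv_sat a b M (index_set sigma) (index_set eps) q
      (fun y : R => 0 <= (-1) ^+ (n - q) * y).
  move=> odd_nq; congr green_deriv_sat; apply/funext => y.
  by rewrite -signr_odd odd_nq mulN1r oppr_ge0.
(* For n - k even the sign [w] is 1, so m = -M and the first eigenvalue corresponds to mu = -
   lambda1; for n - k odd it is -1, so m = M and mu = lambda1. *)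
split=> [/negbTE even_nk|odd_nk] lambda1 [l0 eig ext].
  have {}main M := main (- lambda1) M; rewrite -signr_odd even_nk expr0 in main.
  have {}main M : green_deriv_sat a b M (index_set sigma) (index_set eps) q
      (fun y : R => 0 <= (-1) ^+ (n - q) * y) <-> lambda1 < M <= 0.
    have -> : (lambda1 < M <= 0) = (0 <= - (1 * M) < - lambda1).
      by rewrite mul1r oppr_ge0 ltrN2 andbC.
    apply: main; rewrite ?oppr_gt0// ?mul1r ?opprK// => m m0 ml eig_m.
    have := ext _ eig_m; rewrite mul1r oppr_lt0 => /(_ m0).
    by lra.
  by split=> parity M; [rewrite nonnegE|rewrite nonposE].
have {}main M := main lambda1 M; rewrite -signr_odd odd_nk expr1 in main.
have {}main M : green_deriv_sat a b M (index_set sigma) (index_set eps) q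
    (fun y : R => 0 <= (-1) ^+ (n - q) * y) <-> 0 <= M < lambda1.
  have -> : (0 <= M < lambda1) = (0 <= - (-1 * M) < lambda1) by rewrite mulN1r opprK.
  apply: main; rewrite ?mulN1r ?opprK// => m m0 ml; rewrite mulN1r opprK => eig_m.
  by have := ext _ eig_m m0; lra.
by split=> parity M; [rewrite nonnegE|rewrite nonposE].
Qed.
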